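(* Let $1\le p<\infty$, $r,s\in\mathbb{N}$ with $s\le 2r$, and let $(G_n)_{n\in\mathbb{N}}$ be a family of linear sampling operators with nodes $X_n=(x_{k,n})_{k=1}^n$ and separation constant $\gamma\in(0,1]$ (see context). Suppose that there are constants $K_1,K_3>0$ such that $$\|G_n(f)\|_p\le K_1\|f\|_{\ell_p(X_n)}\quad\text{for all } f\in L_p(\mathbb{T}),\ n\in\mathbb{N},$$ $$\|f-G_n(f)\|_p\le K_3n^{-s}\|f^{(s)}\|_p\quad\text{for all } f\in W_p^s(\mathbb{T}),\ n\in\mathbb{N}.$$ Then there is a constant $C_1>0$ independent of $f$ and $n$ such that for all $f\in L_p(\mathbb{T})$ and $n\in\mathbb{N}$ $$\|f-G_n(f)\|_p\le K_1\|f_{\gamma/n,\,r}-f\|_{\ell_p(X_n)}+C_1\,\omega_s(f,1/n)_p .$$ If, additionally, there is a constant $K_2>0$ such that $$K_2\|f\|_{\ell_p(X_n)}\le\|G_n(f)\|_p\quad\text{for all } f\in L_p(\mathbb{T}),\ n\in\mathbb{N},$$ then there is a constant $C_2>0$ independent of $f$ and $n$ such that for all $f\in L_p(\mathbb{T})$ and $n\in\mathbb{N}$ $$K_2\|f_{\gamma/n,\,r}-f\|_{\ell_p(X_n)}-C_2\,\omega_s(f,1/n)_p\le\|f-G_n(f)\|_p .$$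
   Context: $\mathbb{T}=[0,1)$. For $1\le p<\infty$, $L_p(\mathbb{T})$ is the space of all 1-periodic measurable functions $f$, finite at every point, with $\|f\|_p=(\int_0^1|f(x)|^p\,dx)^{1/p}<\infty$; functions coinciding almost everywhere are not identified, so $f\in L_p(\mathbb{T})$ is given by its value at each point. For $s\in\mathbb{N}$, $f\in W_p^s(\mathbb{T})$ means that $f$ is 1-periodic, $f^{(s-1)}$ is absolutely continuous and $f^{(s)}\in L_p(\mathbb{T})$. For a set of $n$ points $X_n=(x_{k,n})_{k=1}^n$, $\|f\|_{\ell_p(X_n)}=\big(\frac1n\sum_{k=1}^n|f(x_{k,n})|^p\big)^{1/p}$. Modulus of smoothness: for $s\in\mathbb{N}$, $\delta>0$, $\omega_s(f,\delta)_p=\sup_{0<h<\delta}\|\Delta_h^sf\|_p$, where $\Delta_h^sf(x)=\sum_{\nu=0}^s\binom{s}{\nu}(-1)^\nu f(x+(s-\nu)h)$. Generalized Steklov average: for $r\in\mathbb{N}$, $\delta>0$ and integrable $f$, $$f_{\delta,r}(x)=(-1)^{r+1}\binom{2r}{r}^{-1}\frac2\delta\int_{-\delta/2}^{\delta/2}\sum_{\nu=0}^{r-1}(-1)^\nu\binom{2r}{\nu}f\Big(x+\frac{r-\nu}{r}t\Big)dt .$$ Sampling operators: for each $n\in\mathbb{N}$, $G_n(f)(x)=\sum_{k=1}^nf(x_{k,n})\varphi_{k,n}(x)$, where $\varphi_{k,n}\in L_p(\mathbb{T})$ are fixed 1-periodic functions and the nodes $X_n=(x_{k,n})_{k=1}^n$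 satisfy $0\le x_{1,n}<x_{2,n}<\dots<x_{n,n}<1$. It is assumed that $\gamma\in(0,1]$ is such that $\min_{1\le k\le n}(x_{k+1,n}-x_{k,n})\ge\gamma/n$ for all $n\in\mathbb{N}$, where $x_{n+1,n}=1+x_{1,n}$. *)

(* Defs.v *)
From HB Require Import structures.
From mathcomp Require Import all_boot all_order all_algebra.
From mathcomp Require Import all_classical all_reals all_analysis.

Set Implicit Arguments.
Unset Strict Implicit.
Unset Printing Implicit Defensive.

Import Order.TTheory GRing.Theory Num.Theory.
Import numFieldNormedType.Exports.

Local Open Scope classical_set_scope.
Local Open Scope ring_scope.

(* The carrier R with the sigma-algebra of Lebesgue measurable sets. Since
   functions are not identified up to a.e. equality, Borel measurability
   (the default structure on R) would give a smaller class of functions. *)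
Notation lebesgueTypeR R :=
  (caratheodory_type (mu_ext (wlength (@idfun (Real.sort R))))).

Section Spaces.
Context {R : realType}.
Local Notation leb := (@completed_lebesgue_measure R).
Implicit Types (p d h : R) (f : R -> R) (s r n : nat).

(* Extended-real valued; real exponents p >= 1 only. *)
Definition Lpnorm p f : \bar R :=
  ('N[leb]_(p%:E)[EFin \o (f \_ `[0%R, 1%R[)])%E.

Definition inLp p f : Prop :=
  [/\ periodic f 1,
      measurable_fun [set: lebesgueTypeR R] (f : lebesgueTypeR R -> R) &
      (Lpnorm p f < +oo)%E].

Definition abs_cont_on (a b : R) f : Prop :=
  forall e : R, 0 < e -> exists2 d : R, 0 < d &
    forall (m : nat) (u v : 'I_m -> R),
      (forall i, [/\ a <= u i, u i < v i & v i <= b]) ->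
      trivIset [set: 'I_m] (fun i => `]u i, v i[%classic) ->
      \sum_(i < m) (v i - u i) < d ->
      \sum_(i < m) `|f (v i) - f (u i)| < e.

(* Meant for s >= 1. The derivatives of order < s exist everywhere; the one of
   order s exists only almost everywhere, and [derive1n] takes some fixed
   default value at the exceptional points. For a periodic function, absolute
   continuity on the closed interval [0, 1] gives it on every bounded one. *)
Definition inW p s f : Prop :=
  [/\ periodic f 1,
      forall i : nat, (i < s.-1)%N -> forall x : R, derivable (f^`(i))%classic x 1,
      abs_cont_on 0 1 (f^`(s.-1))%classic &
      inLp p (f^`(s))%classic].

Definition lpnorm p n (X : 'I_n -> R) f : R :=
  (n%:R^-1 * \sum_(k < n) `|f (X k)| `^ p) `^ p^-1.

Definition fdiff s h f (x : R) : R :=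
  \sum_(0 <= nu < s.+1) 'C(s, nu)%:R * (-1) ^+ nu * f (x + (s%:R - nu%:R) * h).

Definition modulus s f d p : \bar R :=
  ereal_sup [set Lpnorm p (fdiff s h f) | h in `]0, d[%classic].

Definition steklov d r f (x : R) : R :=
  (-1) ^+ r.+1 * ('C(2 * r, r)%:R)^-1 * (2 / d) *
  \int[leb]_(t in (`[- (d / 2), d / 2] : set (lebesgueTypeR R)))
    (\sum_(0 <= nu < r)
       (-1) ^+ nu * 'C(2 * r, nu)%:R * f (x + (r%:R - nu%:R) / r%:R * t)).

Definition sampling n (X : 'I_n -> R) (phi : 'I_n -> R -> R) f (x : R) : R :=
  \sum_(k < n) f (X k) * phi k x.

(* The node after the last one is the first one shifted by the period;
   [ordS] is the cyclic successor. *)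
Definition next_node n (X : 'I_n -> R) (k : 'I_n) : R :=
  X (ordS k) + (k.+1 == n)%:R.

Definition ordered_nodes n (X : 'I_n -> R) : Prop :=
  (forall k, 0 <= X k < 1) /\ (forall j k : 'I_n, (j < k)%N -> X j < X k).

Definition separated_nodes n (X : 'I_n -> R) (gamma : R) : Prop :=
  forall k, gamma / n%:R <= next_node X k - X k.

End Spaces.

(* Main.v *)
From HB Require Import structures.
Require Import Defs.
From mathcomp Require Import all_boot all_order all_algebra.
From mathcomp Require Import all_classical all_reals all_analysis.
From mathcomp Require Import measurable_realfun.
From mathcomp Require Import ring lra.
Set Implicit Arguments.
Unset Strict Implicit.
Unset Printing Implicit Defensive.
Import Order.TTheory GRing.Theory Num.Theory.
Import numFieldNormedType.Exports.

Local Open Scope classical_set_scope.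
Local Open Scope ring_scope.

(** The error [f - G f] of a sampling operator is compared with
    the discrete norm of [f_h - f], where [f_h] is the Steklov average of step
    [h = gamma / n], up to a multiple of [omega], the modulus of smoothness
    of order [s] at [1 / n].

    Take a smooth [g] with [||f - g|| <= omega] and
    [||g^(s)|| <= C n^s omega].  In
      [f - G f = (f - g) + (g - G g) + G (g - f)]
    the first two terms are of order [omega], the second one by the hypothesis
    on smooth functions.  The operator only sees values at the nodes, so the
    third term is at most [K1] times the discrete norm of [g - f], and this
    is at most the discrete norm of [f_h - f] plus the one of [f_h - g].  The
    lower estimate follows in the same way from the lower bound on [G (f - g)].
    Both estimates therefore rest on one fact: the discrete norm of [f_h - g]
    is of order [omega].

    For this, write [f_h - g = (f - g)_h + (g_h - g)].  A value of [(f - g)_h]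
    at a node is at most a constant times a mean of [|f - g|] over an interval of length [h]
    about the node ([steklov_le]).  A value of [g_h - g] is a mean of central
    differences of [g] of order [2 r >= s], hence at most a constant times [h^s]
    times a mean of [|g^(s)|] over the same interval ([steklov_sub_le]).  The nodes are at
    least [h] apart on the circle, so these intervals are disjoint modulo 1;
    Hoelder's inequality on each of them bounds the discrete norms by the norms
    of [f - g] and [h^s g^(s)] in [L_p] ([lpnorm_le_Lpnorm]).

    The function [g] is, up to sign, the sum of the terms of
    [Delta_v^s f (x)] other than [f (x)], in which the value of [f] at
    distance [j] steps is replaced by an [s + 1] times iterated mean of [f]
    of width proportional to [j].  Then [f - g] is a mean of differences
    [Delta_v^s f] over steps [v] below [1 / n], and [g^(s)] is a combination of
    means of such differences; Minkowski's inequality for means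
    ([Lpnorm_average]) gives the two bounds on [g].

    The functions at hand are Lebesgue measurable, whereas Tonelli's theorem
    needs [F (x + t)] to be jointly measurable in [(x, t)], which holds for
    Borel [F].  So [f] is replaced by a periodic Borel function equal to it
    almost everywhere; this leaves all integrals unchanged, and the values of
    [f] itself enter only through discrete norms. *)

(** * Borel functions and the completed Lebesgue measure *)

Section Completion.
Context {R : realType}.
Local Notation mu := (@lebesgue_measure R).
Local Notation leb := (@completed_lebesgue_measure R).
Local Notation T := (lebesgueTypeR R).

Lemma measurable_lebesgue (A : set R) :
  measurable A -> measurable (A : set T).
Proof. exact: sub_caratheodory. Qed.

Lemma measurable_fun_lebesgue d (Y : measurableType d) (f : R -> Y) :
  measurable_fun [set: R] f -> measurable_fun [set: T] (f : T -> Y).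
Proof.
move=> mf _ B mB; rewrite setTI; apply: measurable_lebesgue.
by rewrite -(setTI (f @^-1` B)); apply: mf.
Qed.

(** The identity from the line with its Lebesgue sets to the line with its Borel
    sets is measurable and maps the completed measure to Lebesgue measure. *)
Lemma integral_completed (D : set R) (F : R -> \bar R) :
  measurable D -> measurable_fun [set: R] F ->
  (\int[leb]_(x in (D : set T)) F x = \int[mu]_(x in D) F x)%E.
Proof.
move=> mD mF.
have mid : measurable_fun [set: T] (idfun : T -> measurableTypeR R).
  by apply: measurable_fun_lebesgue; exact: measurable_id.
have ge0E (G : R -> \bar R) : measurable_fun [set: R] G ->
    (forall x, 0%R <= G x)%E ->
    (\int[leb]_(x in (D : set T)) G x = \int[mu]_(x in D) G x)%E.
  move=> mG G0; have := @ge0_integral_pushforward _ _ _ _ _ _ mid leb D G mD.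
  move=> <-; [exact: eq_measure_integral|exact: measurable_funTS|by []].
rewrite integralE [RHS]integralE; congr (_ - _)%E; apply: ge0E => //.
  exact: measurable_funepos.
exact: measurable_funeneg.
Qed.

Lemma ae_completed (P : R -> Prop) :
  {ae mu, forall x, P x} -> {ae leb, forall x, P x}.
Proof.
move=> [N [mN N0 PN]]; exists N; split => //; exact: measurable_lebesgue.
Qed.

Lemma ae_measurable_fun_lebesgue (f g : R -> R) :
  measurable_fun [set: R] g -> {ae mu, forall x, f x = g x} ->
  measurable_fun [set: T] (f : T -> R).
Proof.
move=> mg fg; apply/measurable_EFinP.
apply: (ae_measurable_fun (@completed_lebesgue_measure_is_complete R)
  (f := EFin \o g)).
  by apply: (filterS (F := almost_everywhere leb) _ (ae_completed fg)) => x + _ /= => ->.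
by apply/measurable_EFinP; exact: measurable_fun_lebesgue.
Qed.

Lemma ae_integral_completed (D : set R) (f g : R -> R) :
  measurable D -> measurable_fun [set: R] g ->
  {ae mu, forall x, f x = g x} ->
  (\int[leb]_(x in (D : set T)) (f x)%:E = \int[mu]_(x in D) (g x)%:E)%E.
Proof.
move=> mD mg fg; rewrite -integral_completed//; last exact/measurable_EFinP.
apply: (@ae_eq_integral _ _ _ leb D (EFin \o g) (EFin \o f)).
- exact: measurable_lebesgue.
- apply/measurable_funTS/measurable_EFinP.
  exact: ae_measurable_fun_lebesgue fg.
- exact/measurable_funTS/measurable_EFinP/measurable_fun_lebesgue.
- by apply: (filterS (F := almost_everywhere leb) _ (ae_completed fg)) => x + _ /= => ->.
Qed.

End Completion.

(** * Affine changes of variable *)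

Section Affine.
Context {R : realType}.
Local Notation mu := (@lebesgue_measure R).

Lemma measurable_fun_affine (a b : R) :
  measurable_fun [set: R] (fun x : R => a * x + b).
Proof. by apply: measurable_funD => //; exact: measurable_funM. Qed.

Lemma measurable_comp_affine d (Y : measurableType d) (F : R -> Y) (a b : R) :
  measurable_fun [set: R] F -> measurable_fun [set: R] (fun x => F (a * x + b)).
Proof. by move=> mF; exact: (measurableT_comp mF (measurable_fun_affine a b)). Qed.

Lemma affine_preimage_itvoc (a b c d : R) : 0 < a ->
  (fun x => a * x + b) @^-1` `]c, d] = `](c - b) / a, (d - b) / a]%classic.
Proof.
move=> a0; apply/seteqP; split=> x /=; rewrite !in_itv/=.
  by rewrite ltr_pdivrMr// ler_pdivlMr// ltrBlDr lerBrDr (mulrC x).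
by rewrite ltr_pdivrMr// ler_pdivlMr// ltrBlDr lerBrDr (mulrC x).
Qed.

Let affine (a b : R) : measurableTypeR R -> measurableTypeR R :=
  fun x => a * x + b.

Let measurable_affine a b : measurable_fun [set: measurableTypeR R] (affine a b).
Proof. exact: measurable_fun_affine. Qed.

Let affine_measure (a b : R) : {measure set (measurableTypeR R) -> \bar R} :=
  measure_function_pushforward__canonical__measure_function_Measure mu
    (measurable_affine a b).

(** Both sides are measures, so it is enough to compare them on half-open
    intervals. *)
Lemma lebesgue_measure_affine (a b : R) (A : set R) : 0 < a -> measurable A ->
  mu A = (a%:E * mu ((fun x => (a * x + b)%R) @^-1` A))%E.
Proof.
move=> a0 mA; pose k : {nonneg R} := NngNum (ltW a0).
rewrite [RHS](_ : _ = mscale k (affine_measure a b) A)//.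
apply: lebesgue_measure_unique => // _ [[c d]] _ <- /=.
rewrite /mscale /= /pushforward /affine/=.
rewrite [X in (_ * mu X)%E](affine_preimage_itvoc b c d a0).
rewrite !lebesgue_measure_itv/= !lte_fin ltr_pM2r ?invr_gt0// ltrD2r.
case: ifPn => _; last by rewrite mule0.
rewrite -EFinB -EFinM; congr EFin; rewrite -mulrBl mulrCA divff ?gt_eqF//.
by rewrite mulr1 opprB addrA subrK.
Qed.

Lemma ge0_integral_affine (a b : R) (D : set R) (F : R -> \bar R) :
  0 < a -> measurable D -> measurable_fun [set: R] F ->
  (forall x, 0 <= F x)%E ->
  (\int[mu]_(x in D) F x =
   a%:E * \int[mu]_(x in (fun x => (a * x + b)%R) @^-1` D) F (a * x + b)%R)%E.
Proof.
move=> a0 mD mF F0; pose k : {nonneg R} := NngNum (ltW a0).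
transitivity (\int[mscale k (affine_measure a b)]_(x in D) F x)%E.
  apply: eq_measure_integral => A mA _.
  exact: lebesgue_measure_affine.
rewrite ge0_integral_mscale//; last exact: measurable_funTS.
congr (_ * _)%E.
have := @ge0_integral_pushforward _ _ _ _ _ _ (measurable_affine a b) mu D F mD.
by apply => //; exact: measurable_funTS.
Qed.

Lemma ae_affine (a b : R) (P : R -> Prop) : 0 < a ->
  {ae mu, forall x, P x} -> {ae mu, forall x, P (a * x + b)}.
Proof.
move=> a0 [N [mN N0 PN]].
exists ((fun x => a * x + b) @^-1` N); split.
- rewrite -[X in measurable X]setTI; exact: (measurable_fun_affine a b).
- have := lebesgue_measure_affine b a0 mN.
  rewrite N0 => /esym/eqP; rewrite mule_eq0 eqe gt_eqF//= => /eqP//.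
- by move=> x /= Px; apply: PN.
Qed.

End Affine.

(** * Periodic Borel representatives *)

Section BorelVersion.
Context {R : realType}.
Local Notation mu := (@lebesgue_measure R).
Local Notation T := (lebesgueTypeR R).

Lemma lebesgue_set_decomp (A : set R) : measurable (A : set T) ->
  exists B N : set R, [/\ measurable B, measurable N, mu N = 0%E &
    forall x, ~ N x -> A x <-> B x].
Proof.
move=> mA.
have : (completed_algebra_gen mu).-sigma.-measurable A.
  by rewrite completed_caratheodory_measurable.
rewrite g_sigma_completed_algebra_genE => -[B mB [M [N [mN N0 MN]] BMA]].
exists B, N; split => // x Nx; rewrite -BMA; split; last by left.
by case=> // /MN.
Qed.

Lemma measurable_fun_lt_rat (f : R -> R) :
  (forall q : rat, measurable [set x | f x < ratr q]) ->
  measurable_fun [set: R] f.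
Proof.
move=> mf.
apply: (measurability _ (RGenInftyO.measurableE R)).
move=> _ [_ [a ->]] <-; rewrite setTI.
rewrite (_ : f @^-1` `]-oo, a[ =
    \bigcup_(q in [set q : rat | ratr q < a]) [set x | f x < ratr q]).
  rewrite bigcup_mkcond; apply: countable_bigcupT_measurable => // q.
  by case: ifP => // _; exact: mf.
apply/seteqP; split=> x /=; rewrite in_itv/=.
  by move=> /rat_in_itvoo[q]; rewrite in_itv/= => /andP[xq qa]; exists q.
by case=> q /= qa /lt_trans; exact.
Qed.

(** A single exceptional set has to serve countably many level sets at once and be
    periodic: the union of all integer translates does both. *)
Lemma null_translates (N : nat -> set R) :
  (forall n, measurable (N n)) -> (forall n, mu (N n) = 0%E) ->
  exists M : set R, [/\ measurable M, mu M = 0%E, forall n, N n `<=` M &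
    forall x, M (x + 1) <-> M x].
Proof.
move=> mN N0.
pose S (k : int) n : set R := (fun x => 1 * x + k%:~R) @^-1` N n.
have mS k n : measurable (S k n).
  by rewrite -[S k n]setTI; exact: (measurable_fun_affine 1 k%:~R).
have S0 k n : mu (S k n) = 0%E.
  have := lebesgue_measure_affine k%:~R ltr01 (mN n).
  by rewrite N0 mul1e => ->.
have mU : measurable (\bigcup_(k : int) \bigcup_n S k n).
  apply: countable_bigcupT_measurable => // k; exact: bigcupT_measurable.
exists (\bigcup_(k : int) \bigcup_n S k n); split => //.
- apply/negligibleP => //.
  rewrite (_ : \bigcup_k _ = \bigcup_i
    (if unpickle i is Some k then \bigcup_n S k n else set0)).
    apply: negligible_bigcup => i; case: unpickle => [k|]; last exact: negligible_set0.
    apply: negligible_bigcup => n; apply/negligibleP; [exact: mS|exact: S0].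
  apply/seteqP; split=> x [k _] h.
    by exists (pickle k); [exact: I|rewrite pickleK].
  by move: h; case: unpickle => // k' h; exists k'.
- by move=> n x Nx; exists 0 => //; exists n => //; rewrite /S/= mul1r addr0.
- move=> x; split => -[k _ [n _ Sx]].
    exists (k + 1) => //; exists n => //; move: Sx; rewrite /S/= !mul1r.
    by rewrite rmorphD/= (addrC k%:~R) addrA.
  exists (k - 1) => //; exists n => //; move: Sx; rewrite /S/= !mul1r.
  by rewrite rmorphB/= -addrA (addrCA 1) subrr addr0.
Qed.

(** Each set [f < q] with [q] rational is Borel outside a null set.  Setting [f] to
    0 on a periodic null set containing all these exceptional sets makes every such
    set Borel and keeps the period. *)
Lemma periodic_borel_version (f : R -> R) :
  measurable_fun [set: T] (f : T -> R) -> periodic f 1 ->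
  exists f0 : R -> R, [/\ measurable_fun [set: R] f0, periodic f0 1 &
    {ae mu, forall x, f x = f0 x}].
Proof.
move=> mf pf.
have mA (q : rat) : measurable ([set x | f x < ratr q] : set T).
  rewrite (_ : [set x | f x < ratr q] = setT `&` f @^-1` `]-oo, ratr q[).
    by apply: mf.
  by rewrite setTI; apply/seteqP; split=> x /=; rewrite in_itv.
pose B q := projT1 (cid (lebesgue_set_decomp (mA q))).
pose N q := projT1 (cid (projT2 (cid (lebesgue_set_decomp (mA q))))).
have BN q : [/\ measurable (B q), measurable (N q), mu (N q) = 0%E &
    forall x, ~ N q x -> f x < ratr q <-> B q x].
  exact: (projT2 (cid (projT2 (cid (lebesgue_set_decomp (mA q)))))).
pose N' n := if unpickle n is Some q then N q else set0.
have [|n|M [mM M0 NM pM]] := @null_translates N'.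
- by move=> n; rewrite /N'; case: unpickle => // q; have [] := BN q.
- by rewrite /N'; case: unpickle => // q; have [] := BN q.
exists (f \_ (~` M)); split.
- apply: measurable_fun_lt_rat => q.
  rewrite (_ : [set x | _] = (B q `&` ~` M) `|` (if (0 : R) < ratr q then M else set0)).
    apply: measurableU; last by case: ifP.
    by apply: measurableI; [have [] := BN q|exact: measurableC].
  have Nq x : ~ M x -> (f x < ratr q <-> B q x).
    move=> Mx; have [_ _ _] := BN q; apply => Nx; apply: Mx.
    by apply: (NM (pickle q)); rewrite /N' pickleK.
  have fM x : M x -> (f \_ (~` M)) x = 0 by move=> Mx; rewrite patchE memNset//; apply.
  have fNM x : ~ M x -> (f \_ (~` M)) x = f x by move=> Mx; rewrite patchE mem_set.
  apply/seteqP; split=> x /=.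
    have [Mx|Mx] := pselect (M x); first by rewrite fM// => ->; right.
    by rewrite fNM// => fx; left; split => //; apply/Nq.
  case=> [[Bx Mx]|]; first by rewrite fNM//; exact/Nq.
  by case: ifP => // q0 Mx; rewrite fM.
- move=> x; rewrite !patchE; have -> : (x + 1 \in ~` M) = (x \in ~` M).
    by rewrite !in_setC; congr (~~ _); apply/idP/idP; rewrite !inE => /pM.
  by rewrite pf.
- exists M; split => // x /= fx; apply: contrapT => Mx; apply: fx.
  by rewrite patchE mem_set.
Qed.

End BorelVersion.

(** * Integrals of periodic functions *)

Section PeriodicIntegral.
Context {R : realType}.
Local Notation mu := (@lebesgue_measure R).
Implicit Types F : R -> \bar R.

Lemma periodic_int (Y : Type) (F : R -> Y) :
  (forall x, F (x + 1) = F x) -> forall (k : int) x, F (x + k%:~R) = F x.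
Proof.
move=> pF.
have pn (n : nat) x : F (x + n%:R) = F x.
  by elim: n x => [|n IH] x; rewrite ?addr0// -natr1 addrA pF IH.
case=> n x; first by rewrite pn.
by rewrite NegzE -[in RHS](subrK n.+1%:R x) pn rmorphN.
Qed.

Lemma ge0_integral_itv_split F (a b c : R) : a <= b -> b <= c ->
  measurable_fun [set: R] F -> (forall x, 0 <= F x)%E ->
  (\int[mu]_(x in `[a, c[) F x =
   \int[mu]_(x in `[a, b[) F x + \int[mu]_(x in `[b, c[) F x)%E.
Proof.
move=> ab bc mF F0.
rewrite (@itv_bndbnd_setU _ _ _ (BLeft b)) ?bnd_simp//.
rewrite ge0_integral_setU//; first exact: measurable_funTS.
apply/disj_set2P; rewrite -subset0 => x/=; rewrite !in_itv/= => -[/andP[_ xb]].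
by rewrite leNgt xb.
Qed.

Lemma ge0_integral_shift_itv F (a b c : R) :
  measurable_fun [set: R] F -> (forall x, 0 <= F x)%E ->
  (\int[mu]_(x in `[(a + c)%R, (b + c)%R[) F x = \int[mu]_(x in `[a, b[) F (x + c)%R)%E.
Proof.
move=> mF F0; rewrite (ge0_integral_affine c ltr01)// mul1e.
rewrite (_ : (fun x => 1 * x + c) @^-1` _ = `[a, b[%classic).
  by apply: eq_integral => x _; rewrite mul1r.
by apply/seteqP; split=> x /=; rewrite !in_itv/= mul1r lerD2r ltrD2r.
Qed.

(** Translation by the integer part of [a] brings [a] into [0, 1); the part of the
    interval beyond 1 is then moved back by one period. *)
Lemma periodic_integral F (a : R) :
  measurable_fun [set: R] F -> (forall x, 0 <= F x)%E ->
  (forall x, F (x + 1)%R = F x) ->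
  (\int[mu]_(x in `[a, (a + 1)%R[) F x = \int[mu]_(x in `[0%R, 1%R[) F x)%E.
Proof.
move=> mF F0 pF.
pose k := Num.floor a; pose b := a - k%:~R.
have b0 : 0 <= b by rewrite subr_ge0 real_floor_le// num_real.
have b1 : b < 1 by rewrite ltrBlDl -intrD1 real_floorD1_gt// num_real.
have ab : a = b + k%:~R by rewrite subrK.
clearbody b; rewrite ab addrAC ge0_integral_shift_itv//.
under eq_integral do rewrite periodic_int//.
rewrite (@ge0_integral_itv_split F b 1 (b + 1))//; [|exact: ltW|by rewrite lerDr].
rewrite -{2}[1]add0r ge0_integral_shift_itv//.
under [X in (_ + X)%E]eq_integral do rewrite pF.
by rewrite addeC -ge0_integral_itv_split// ltW.
Qed.

Lemma periodic_integral_nat F (n : nat) :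
  measurable_fun [set: R] F -> (forall x, 0 <= F x)%E ->
  (forall x, F (x + 1)%R = F x) ->
  forall a, (\int[mu]_(x in `[a, (a + n%:R)%R[) F x =
    n%:R%:E * \int[mu]_(x in `[0%R, 1%R[) F x)%E.
Proof.
move=> mF F0 pF; elim: n => [|n IH] a.
  by rewrite addr0 set_itv_ge ?integral_set0 ?mul0e// bnd_simp ltxx.
have -> : a + n.+1%:R = a + n%:R + 1 by rewrite -addrA natr1.
rewrite (@ge0_integral_itv_split F a (a + n%:R))//; [|by rewrite lerDl..].
by rewrite IH periodic_integral// -natr1 EFinD ge0_muleDl ?mul1e//.
Qed.

End PeriodicIntegral.

(** * The norm of L_p over a period *)

Section LpNorm.
Context {R : realType}.
Local Notation mu := (@lebesgue_measure R).
Local Notation leb := (@completed_lebesgue_measure R).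
Local Notation T := (lebesgueTypeR R).
Implicit Types (p : R) (f g F : R -> R).

Lemma measurable_abs_powR p f :
  measurable_fun [set: R] f ->
  measurable_fun [set: R] (fun x => (`|f x| `^ p)%:E).
Proof.
move=> mf; apply/measurable_EFinP.
apply: (@measurableT_comp _ _ _ _ _ _ (@powR R ^~ p)) => //.
exact: measurableT_comp.
Qed.

Lemma abs_powR_ge0 p f x : (0 <= (`|f x| `^ p)%:E)%E.
Proof. by rewrite lee_fin powR_ge0. Qed.

Definition pow_integral p F : \bar R :=
  (\int[mu]_(x in `[0%R, 1%R[) (`|F x| `^ p)%:E)%E.

Lemma pow_integral_ge0 p F : (0 <= pow_integral p F)%E.
Proof. by apply: integral_ge0 => x _; exact: abs_powR_ge0. Qed.

Lemma Lpnorm_ae p f F : 0 < p -> measurable_fun [set: R] F ->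
  {ae mu, forall x, f x = F x} -> Lpnorm p f = (pow_integral p F `^ p^-1)%E.
Proof.
move=> p0 mF fF; rewrite /Lpnorm unlock; congr (_ `^ _)%E.
have mFp : measurable_fun [set: R] (fun x => `|F x| `^ p).
  by apply/measurable_EFinP; exact: measurable_abs_powR.
have fFp : {ae mu, forall x, `|f x| `^ p = `|F x| `^ p}.
  by apply: (filterS (F := almost_everywhere mu) _ fF) => x ->.
rewrite /pow_integral -(ae_integral_completed (measurable_itv _) mFp fFp).
rewrite [RHS]integral_mkcond; apply: eq_integral => x _.
rewrite /= !patchE; case: ifP => // _ /=.
by rewrite normr0 powR0// gt_eqF.
Qed.

Lemma ae_refl (F : R -> R) : {ae mu, forall x, F x = F x}.
Proof. exact: aeW. Qed.

Lemma Lpnorm_borel p F : 0 < p -> measurable_fun [set: R] F ->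
  Lpnorm p F = (pow_integral p F `^ p^-1)%E.
Proof. by move=> p0 mF; exact: (Lpnorm_ae p0 mF (ae_refl F)). Qed.

Lemma Lpnorm_ge0 p f : (0 <= Lpnorm p f)%E.
Proof. exact: Lnorm_ge0. Qed.

Lemma LpnormD p f g : 1 <= p ->
  measurable_fun [set: T] (f : T -> R) -> measurable_fun [set: T] (g : T -> R) ->
  (Lpnorm p (f \+ g)%R <= Lpnorm p f + Lpnorm p g)%E.
Proof.
move=> p1 mf mg.
have mr (h : T -> R) : measurable_fun [set: T] h ->
    measurable_fun [set: T] (h \_ (`[0%R, 1%R[ : set T)).
  move=> mh; apply/(measurable_restrictT _ _).1.
    exact: (@measurable_lebesgue R `[0%R, 1%R[).
  exact: measurable_funTS.
apply: le_trans (minkowski_EFin leb (mr _ mf) (mr _ mg) p1).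
rewrite /Lpnorm le_eqVlt; apply/orP; left; apply/eqP.
by apply: eq_Lnorm => x /=; rewrite !patchE; case: ifP; rewrite ?addr0.
Qed.

Lemma Lpnorm_eq p f g : f =1 g -> Lpnorm p f = Lpnorm p g.
Proof. by move=> /funext ->. Qed.

Lemma LpnormN p f : Lpnorm p (fun x => - f x) = Lpnorm p f.
Proof.
rewrite /Lpnorm -oppe_Lnorm; apply: eq_Lnorm => x /=.
by rewrite !patchE; case: ifP; rewrite ?opprK ?oppr0.
Qed.

Lemma LpnormZ p (c : R) F : 0 < p -> measurable_fun [set: R] F ->
  Lpnorm p (fun x => (c * F x)%R) = (`|c|%:E * Lpnorm p F)%E.
Proof.
move=> p0 mF; rewrite !Lpnorm_borel//; last exact: measurable_funM.
rewrite /pow_integral; under eq_integral => x _ do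
  rewrite normrM powRM// EFinM.
rewrite ge0_integralZl//=; last first.
  by apply: measurable_funTS; exact: measurable_abs_powR.
rewrite poweRM ?lee_fin ?powR_ge0//; last exact: pow_integral_ge0.
by rewrite poweR_EFin -powRrM divff ?gt_eqF// powRr1.
Qed.

Lemma Lpnorm0 p : 0 < p -> Lpnorm p (fun=> 0 : R) = 0%E.
Proof.
move=> p0; rewrite Lpnorm_borel// /pow_integral.
under eq_integral => x _ do rewrite normr0 powR0 ?gt_eqF//.
by rewrite integral0 poweR0r// invr_eq0 gt_eqF.
Qed.

Lemma Lpnorm_sum p (I : Type) (s : seq I) (F : I -> R -> R) : 1 <= p ->
  (forall i, measurable_fun [set: R] (F i)) ->
  (Lpnorm p (fun x => \sum_(i <- s) F i x)%R <= \sum_(i <- s) Lpnorm p (F i))%E.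
Proof.
move=> p1 mF; have p0 : 0 < p by exact: lt_le_trans p1.
elim: s => [|i s IH].
  by rewrite big_nil; rewrite (Lpnorm_eq p (g := fun=> 0)) ?Lpnorm0// => x; rewrite big_nil.
rewrite big_cons (Lpnorm_eq p (g := F i \+ (fun x => \sum_(j <- s) F j x))).
  refine (le_trans _ (leeD2l (Lpnorm p (F i)) IH)).
  apply: LpnormD; [exact: p1| |].
    exact: measurable_fun_lebesgue.
  by apply: measurable_fun_lebesgue; exact: measurable_sum.
by move=> x; rewrite big_cons.
Qed.

Lemma Lpnorm_shift p c F : 0 < p -> measurable_fun [set: R] F ->
  periodic F 1 -> Lpnorm p (fun x => F (x + c)) = Lpnorm p F.
Proof.
move=> p0 mF pF.
have mFc : measurable_fun [set: R] (fun x => F (x + c)).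
  have := measurable_comp_affine 1 c mF.
  by under eq_fun do rewrite mul1r.
suff e : pow_integral p (fun x => F (x + c)) = pow_integral p F.
  by rewrite (Lpnorm_borel p0 mFc) (Lpnorm_borel p0 mF) e.
pose G x := (`|F x| `^ p)%:E.
have mG : measurable_fun [set: R] G by exact: measurable_abs_powR.
have G0 x : (0 <= G x)%E by exact: abs_powR_ge0.
have pG x : G (x + 1) = G x by rewrite /G pF.
have := ge0_integral_shift_itv 0 1 c mG G0.
rewrite add0r (addrC 1) (periodic_integral c mG G0 pG) => e.
exact: esym e.
Qed.

End LpNorm.

(** * Means and powers *)

Section Jensen.
Context {R : realType}.
Local Notation mu := (@lebesgue_measure R).
Implicit Types (p : R) (F : R -> R).

(** Hoelder against the indicator function of [D].  The case [p = 1], whose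
    conjugate exponent is infinite, is an equality. *)
Lemma hoelder_set (D : set R) (d p : R) F : 1 <= p -> measurable D ->
  0 < d -> mu D = d%:E -> measurable_fun [set: R] F ->
  ((\int[mu]_(x in D) (`|F x|)%:E) `^ p <=
   (d `^ (p - 1))%:E * \int[mu]_(x in D) (`|F x| `^ p)%:E)%E.
Proof.
move=> p1 mD d0 muD mF.
have I0 q : (0 <= \int[mu]_(x in D) (`|F x| `^ q)%:E)%E.
  by apply: integral_ge0 => x _; rewrite lee_fin powR_ge0.
have I10 : (0 <= \int[mu]_(x in D) (`|F x|)%:E)%E.
  by apply: integral_ge0 => x _; rewrite lee_fin.
have p0 : 0 < p by exact: lt_le_trans p1.
have [->|pneq1] := eqVneq p 1.
  rewrite poweRe1// subrr powRr0 mul1e.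
  by under [leRHS]eq_integral do rewrite powRr1//.
have p1' : 1 < p by rewrite lt_neqAle eq_sym pneq1.
pose q := p / (p - 1).
have q0 : 0 < q by rewrite divr_gt0// subr_gt0.
have pq : p^-1 + q^-1 = 1.
  by rewrite /q invf_div -[X in X + _]mul1r -mulrDl addrC subrK divff// gt_eqF.
have mFD : measurable_fun [set: R] (F \_ D).
  by apply/(measurable_restrictT _ _).1 => //; exact: measurable_funTS.
have m1 : measurable_fun [set: R] (\1_D : R -> R) by exact: measurable_indic.
have := hoelder mu mFD m1 p0 q0 pq.
rewrite Lnorm1 unlock.
have -> : (\int[mu]_x `|(EFin \o ((F \_ D) \* \1_D)%R) x| = \int[mu]_(x in D) (`|F x|)%:E)%E.
  rewrite [RHS]integral_mkcond; apply: eq_integral => x _ /=.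
  rewrite !patchE indicE; case: ifP => _ /=; first by rewrite mulr1.
  by rewrite mul0r normr0.
have -> : (\int[mu]_x `|(EFin \o F \_ D) x| `^ p = \int[mu]_(x in D) (`|F x| `^ p)%:E)%E.
  rewrite [RHS]integral_mkcond; apply: eq_integral => x _ /=.
  rewrite !patchE; case: ifP => _ //=.
  by rewrite normr0 powR0// gt_eqF.
have -> : (\int[mu]_x `|(EFin \o \1_D) x| `^ q = d%:E)%E.
  transitivity (\int[mu]_(x in D) (cst 1%:E x))%E.
    rewrite [RHS]integral_mkcond; apply: eq_integral => x _ /=.
    rewrite !patchE indicE; case: ifP => _ /=; first by rewrite normr1 powR1.
    by rewrite normr0 powR0// gt_eqF.
  by rewrite integral_cst//= mul1e; exact: muD.
move=> H.
have {H} := @gt0_ler_poweR R p (ltW p0) _ _ _ _ H.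
rewrite !in_itv/= !leey !andbT I10 mule_ge0 ?poweR_ge0 ?lee_fin ?powR_ge0//.
move=> /(_ isT isT) /le_trans; apply.
rewrite poweRM ?poweR_ge0 ?lee_fin ?powR_ge0// -!poweRrM mulVf ?gt_eqF// poweRe1//.
rewrite poweR_EFin -powRrM muleC.
suff -> : q^-1 * p = p - 1 by [].
by rewrite /q invf_div mulfVK ?gt_eqF.
Qed.

End Jensen.

Section MinkowskiAverage.
Context {R : realType}.
Local Notation mu := (@lebesgue_measure R).
Implicit Types (p : R) (F : R -> R).

Lemma ge0_fubini_set (K : R * R -> \bar R) (A B : set R) :
  measurable_fun [set: R * R] K -> (forall z, 0 <= K z)%E ->
  measurable A -> measurable B ->
  (\int[mu]_(x in A) \int[mu]_(t in B) K (x, t) =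
   \int[mu]_(t in B) \int[mu]_(x in A) K (x, t))%E.
Proof.
move=> mK K0 mA mB.
pose K' := K \_ (A `*` B).
have mK' : measurable_fun [set: R * R] K'.
  apply/(measurable_restrictT _ _).1; first exact: measurableX.
  exact: measurable_funTS.
have K'0 z : (0 <= K' z)%E by rewrite /K' patchE; case: ifP.
have K'E x t : K' (x, t) = ((fun x => (K (x, t))) \_ A \_ (fun=> B t)) x.
  rewrite /K' !patchE; apply/esym.
  have [Bt|Bt] := pselect (B t).
    rewrite mem_set//; have [Ax|Ax] := pselect (A x).
      by rewrite !mem_set//; split.
    by rewrite !memNset// => -[].
  by rewrite !memNset// => -[].
transitivity (\int[mu]_x \int[mu]_t K' (x, t))%E.
  rewrite integral_mkcond; apply: eq_integral => x _.
  rewrite patchE; case: ifPn => [/set_mem Ax|Ax].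
    rewrite integral_mkcond; apply: eq_integral => t _.
    rewrite K'E !patchE (mem_set Ax).
    by have [Bt|Bt] := pselect (B t); [rewrite !mem_set|rewrite !memNset].
  rewrite integral0_eq// => t _; rewrite K'E !patchE (negbTE Ax).
  by case: ifP.
rewrite (@fubini_tonelli _ _ _ _ _ mu mu K' mK' K'0).
apply/esym; rewrite integral_mkcond; apply: eq_integral => t _.
rewrite patchE; case: ifPn => [/set_mem Bt|/negP Bt].
  rewrite integral_mkcond; apply: eq_integral => x _.
  by rewrite K'E !patchE (mem_set (A := fun=> B t) (u := x)).
rewrite integral0_eq// => x _; rewrite K'E patchE memNset//.
by move=> Bt'; apply: Bt; exact/mem_set.
Qed.

Lemma measurable_integral_set (K : R * R -> \bar R) (B : set R) :
  measurable_fun [set: R * R] K -> (forall z, 0 <= K z)%E -> measurable B ->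
  measurable_fun [set: R] (fun x => \int[mu]_(t in B) K (x, t))%E.
Proof.
move=> mK K0 mB.
pose K' := K \_ ([set: R] `*` B).
have mK' : measurable_fun [set: R * R] K'.
  apply/(measurable_restrictT _ _).1; first exact: measurableX.
  exact: measurable_funTS.
have K'0 z : (0 <= K' z)%E by rewrite /K' patchE; case: ifP.
have := @measurable_fun_fubini_tonelli_F _ _ _ _ _ mu K' mK' K'0.
congr measurable_fun; apply/funext => x; rewrite [RHS]integral_mkcond.
apply: eq_integral => t _; rewrite /K' !patchE.
have [Bt|Bt] := pselect (B t); first by rewrite !mem_set.
by rewrite !memNset// => -[].
Qed.

Lemma abs_fine_le (y : \bar R) : (`|fine y|%:E <= `|y|)%E.
Proof. by case: y => [r| |] //=; rewrite ?normr0 ?leey. Qed.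

Lemma abs_Rintegral_le (D : set R) F : measurable D ->
  measurable_fun [set: R] F ->
  (`|\int[mu]_(t in D) F t|%:E <= \int[mu]_(t in D) (`|F t|)%:E)%E.
Proof.
move=> mD mF; apply: le_trans (abs_fine_le _) _.
apply: (le_trans (le_abse_integral mu mD _)) => //.
by apply: measurable_funTS; apply/measurable_EFinP.
Qed.

(** Minkowski's integral inequality for a mean: Hoelder in [t] at each [x], then
    Tonelli. *)
Lemma Lpnorm_average p (H : R -> R -> R) F (M : \bar R) : 1 <= p ->
  measurable_fun [set: R * R] (fun z => H z.2 z.1) ->
  measurable_fun [set: R] F ->
  (forall x, F x = \int[mu]_(t in `[0, 1]) H t x) ->
  (forall t, t \in `[0, 1] -> (Lpnorm p (H t) <= M)%E) ->
  (Lpnorm p F <= M)%E.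
Proof.
move=> p1 mH mF FE HM; have p0 : 0 < p by exact: lt_le_trans p1.
have pn0 : p != 0 by rewrite gt_eqF.
have M0 : (0 <= M)%E.
  by apply: le_trans (HM 0 _); rewrite ?Lpnorm_ge0// in_itv/= lexx ler01.
have mHt t : measurable_fun [set: R] (H t).
  exact: (measurableT_comp mH (measurable_pair2 t)).
have mHx x : measurable_fun [set: R] (H ^~ x).
  exact: (measurableT_comp mH (measurable_pair1 x)).
pose K (z : R * R) := (`|H z.2 z.1| `^ p)%:E.
have mK : measurable_fun [set: R * R] K.
  apply/measurable_EFinP.
  apply: (@measurableT_comp _ _ _ _ _ _ (@powR R ^~ p)) => //.
  exact: measurableT_comp.
have K0 z : (0 <= K z)%E by rewrite lee_fin powR_ge0.
have mu1 : mu `[0, 1]%classic = 1%:E.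
  by rewrite lebesgue_measure_itv/= lte_fin ltr01 sube0.
have le1 x : ((`|F x| `^ p)%:E <= \int[mu]_(t in `[0%R, 1%R]) K (x, t))%E.
  have mI : measurable (`[0, 1]%classic : set R) by [].
  have := hoelder_set p1 mI ltr01 mu1 (mHx x).
  rewrite powR1 mul1e; apply: le_trans.
  rewrite -poweR_EFin FE; apply: gt0_ler_poweR; first exact: ltW.
  - by rewrite in_itv/= leey andbT.
  - rewrite in_itv/= leey andbT; apply: integral_ge0 => t _.
    by rewrite lee_fin.
  - exact: abs_Rintegral_le.
have leM t : t \in `[0, 1] -> (pow_integral p (H t) <= M `^ p)%E.
  move=> t01; have := HM t t01; rewrite Lpnorm_borel// => h.
  have P0 := pow_integral_ge0 p (H t).
  rewrite -(poweRe1 P0) -(mulVf pn0) poweRrM.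
  apply: gt0_ler_poweR => //; first exact: ltW.
  - by rewrite in_itv/= poweR_ge0 leey.
  - by rewrite in_itv/= M0 leey.
rewrite Lpnorm_borel// -(poweRe1 M0) -(divff pn0) poweRrM.
apply: gt0_ler_poweR; first by rewrite invr_ge0 ltW.
- by rewrite in_itv/= pow_integral_ge0 leey.
- by rewrite in_itv/= poweR_ge0 leey.
apply: (@le_trans _ _ (\int[mu]_(x in `[0%R, 1%R[) \int[mu]_(t in `[0%R, 1%R]) K (x, t))%E).
  apply: ge0_le_integral => //.
  - by apply: measurable_funTS; exact: measurable_abs_powR.
  - by apply: measurable_funTS; exact: measurable_integral_set.
rewrite ge0_fubini_set//.
apply: (@le_trans _ _ (\int[mu]_(t in `[0%R, 1%R]) (cst (M `^ p) t))%E).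
  apply: ge0_le_integral => //.
  - by move=> t _; exact: integral_ge0.
  - apply: measurable_funTS.
    apply: (@measurable_integral_set (fun z => K (z.2, z.1)) `[0, 1[%classic) => //.
    exact: (measurableT_comp mK (@measurable_swap _ _ _ _)).
by rewrite integral_cst//= mu1 mule1.
Qed.

End MinkowskiAverage.

(** * One-sided Steklov means *)

Section Average.
Context {R : realType}.
Local Notation mu := (@lebesgue_measure R).
Implicit Types (a c x : R) (F : R -> R).

(** The mean of [F] over [x, x + a], written on the unit interval so that [a = 0]
    gives [F] itself. *)
Definition average a F x : R := \int[mu]_(t in `[0, 1]) F (x + a * t).

Definition locint F := measurable_fun [set: R] F /\
  forall a b : R, mu.-integrable `[a, b] (EFin \o F).

Lemma continuous_locint F : continuous F -> locint F.
Proof.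
move=> cF; split; first exact: continuous_measurable_fun.
move=> a b; apply: continuous_compact_integrable; first exact: segment_compact.
exact: continuous_subspaceT.
Qed.

Lemma average0 F : average 0 F = F.
Proof.
apply/funext => x; rewrite /average.
under eq_Rintegral do rewrite mul0r addr0.
rewrite Rintegral_cst//= lebesgue_measure_itv/= lte_fin ltr01 sube0/=.
by rewrite mulr1.
Qed.

Lemma integral_affine (a b : R) (D D' : set R) F :
  (fun x => a * x + b) @^-1` D = D' ->
  0 < a -> measurable D -> measurable_fun [set: R] F ->
  mu.-integrable D (EFin \o F) ->
  (\int[mu]_(x in D) (F x)%:E =
   a%:E * \int[mu]_(x in D') (F (a * x + b)%R)%:E)%E.
Proof.
move=> <- {D'} a0 mD mF iF.
have mE : measurable_fun [set: R] (EFin \o F) by exact/measurable_EFinP.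
pose G (x : R) := (F (a * x + b))%:E.
pose D' := (fun x => a * x + b) @^-1` D.
have hp : (\int[mu]_(x in D) (EFin \o F)^\+ x =
    a%:E * \int[mu]_(x in D') G^\+ x)%E.
  rewrite (ge0_integral_affine b a0 mD (measurable_funepos mE) (funepos_ge0 _)).
  by congr (_ * _)%E; apply: eq_integral => x _; rewrite !funeposE.
have hn : (\int[mu]_(x in D) (EFin \o F)^\- x =
    a%:E * \int[mu]_(x in D') G^\- x)%E.
  rewrite (ge0_integral_affine b a0 mD (measurable_funeneg mE) (funeneg_ge0 _)).
  by congr (_ * _)%E; apply: eq_integral => x _; rewrite !funenegE.
have fp : (\int[mu]_(x in D) (EFin \o F)^\+ x)%E \is a fin_num.
  exact: integrable_pos_fin_num.
have Gp0 : (0 <= \int[mu]_(x in D') G^\+ x)%E by apply: integral_ge0.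
rewrite integralE [in RHS]integralE -/D' hp hn.
rewrite hp in fp; rewrite -/G; clear hp hn.
move: Gp0 fp; move: (\int[mu]_(x in D') G^\+ x)%E (\int[mu]_(x in D') G^\- x)%E => y z y0 fy.
rewrite muleBr// fin_num_adde_defr//.
by case: y y0 fy => // _; rewrite gt0_muley.
Qed.

Lemma averageE a F x : 0 < a -> locint F ->
  average a F x = a^-1 * \int[mu]_(y in `[x, x + a]) F y.
Proof.
move=> a0 [mF iF]; rewrite /average /Rintegral.
have D'E : (fun y => a * y + x) @^-1` `[x, x + a] = `[0, 1]%classic.
  by apply/seteqP; split => y /=; rewrite !in_itv/= lerDr pmulr_rge0// addrC
    lerD2l ger_pMr.
rewrite (integral_affine D'E a0 _ mF (iF _ _))//.
under eq_integral do rewrite addrC.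
have fineZ (y : \bar R) : fine (a%:E * y)%E = a * fine y.
  by case: y => [y| |]; rewrite ?mulr0//= ?gt0_muley ?gt0_muleNy.
by rewrite fineZ mulrA mulVf ?mul1r ?gt_eqF.
Qed.

(** Primitives are taken from a base point [c] left of [x]; continuity and
    differentiability, which are local, can be read off with [c = x - 1]. *)
Lemma average_primitive a c F x : 0 < a -> locint F -> c <= x ->
  average a F x = a^-1 * (parameterized_integral mu c (x + a) F -
                          parameterized_integral mu c x F).
Proof.
move=> a0 lF cx; rewrite averageE//; congr (_ * _).
rewrite /parameterized_integral Rintegral_itvB ?bnd_simp//; last 2 first.
- exact: lF.2.
- by rewrite lerDl ltW.
rewrite Rintegral_itv_obnd_cbnd//.
apply: (@integrableS _ _ _ mu `[x, x + a]) => //; last exact: lF.2.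
exact: subset_itv_oc_cc.
Qed.

Lemma continuous_average a F : 0 < a -> locint F -> continuous (average a F).
Proof.
move=> a0 lF x; pose c := x - 1; pose u := x + a + 1.
have cu : c < u by rewrite /c /u; rewrite ltrBlDr -!addrA ltrDl !addr_gt0.
pose P y := parameterized_integral mu c y F.
have cP y : c < y -> y < u -> {for y, continuous P}.
  move=> cy yu; apply: (within_continuous_continuous cu).
    by apply: parameterized_integral_continuous; [exact: ltW|exact: lF.2].
  by rewrite in_itv/= cy.
have cx : c < x by rewrite /c ltrBlDr ltrDl.
have xu : x < u by rewrite /u -addrA ltrDl addr_gt0.
have xau : x + a < u by rewrite /u ltrDl.
have cxa : c < x + a by rewrite (lt_trans cx)// ltrDl.
have E : {near x, (fun y => a^-1 * (P (y + a) - P y)) =1 average a F}.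
  near=> y; rewrite (@average_primitive a c)//.
  by apply: ltW; near: y; exact: lt_nbhsr.
rewrite /continuous_at -(nbhs_singleton E).
apply: cvg_trans; first exact: (near_eq_cvg E).
apply: cvgMr; apply: cvgB; last exact: cP.
apply: (@continuous_comp _ _ _ (fun y => y + a) P); last exact: cP.
by apply: cvgD; [exact: cvg_id|exact: cvg_cst].
Unshelve. all: by end_near. Qed.

Lemma is_derive_average a F x : 0 < a -> continuous F ->
  is_derive x 1 (average a F) (a^-1 * (F (x + a) - F x)).
Proof.
move=> a0 cF; have lF := continuous_locint cF.
pose c := x - 1; pose u := x + a + 1.
pose P y := parameterized_integral mu c y F.
have dP y : c < y -> y < u -> is_derive y 1 P (F y).
  move=> cy yu.
  have [dP <-] := continuous_FTC1_closed yu (lF.2 c u) cy (cF y).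
  by rewrite derive1E; exact: derivableP.
have cx : c < x by rewrite /c ltrBlDr ltrDl.
have xu : x < u by rewrite /u -addrA ltrDl addr_gt0.
have xau : x + a < u by rewrite /u ltrDl.
have cxa : c < x + a by rewrite (lt_trans cx)// ltrDl.
have E : {near x, (fun y => a^-1 * (P (y + a) - P y)) =1 average a F}.
  near=> y; rewrite (@average_primitive a c)//.
  by apply: ltW; near: y; exact: lt_nbhsr.
apply: near_eq_is_derive; first exact: E.
have d1 := dP x cx xu.
have d2 : is_derive x 1 (P \o shift a) (F (x + a) * 1).
  exact: (@is_derive1_comp R P (shift a) x _ _ (dP (x + a) cxa xau) (is_derive_shift x 1 a)).
rewrite mulr1 in d2.
have d3 : is_derive x 1 (a^-1 *: (P \o shift a - P)) (a^-1 *: (F (x + a) - F x)).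
  by apply: is_deriveZ.
exact: d3.
Unshelve. all: by end_near. Qed.

End Average.

(** * Finite differences *)

Section FiniteDifference.
Context {R : realType}.
Local Notation mu := (@lebesgue_measure R).
Implicit Types (h a x : R) (F : R -> R).

Lemma fdiff0 h F : fdiff 0 h F = F.
Proof.
apply/funext => x; rewrite /fdiff big_nat1 bin0 expr0 !mul1r.
by rewrite subrr mul0r addr0.
Qed.

(** Pascal's rule.  Facts on differences of any order follow from it by induction on
    the order. *)
Lemma fdiffS k h F :
  fdiff k.+1 h F = fdiff k h (fun y => F (y + h) - F y).
Proof.
apply/funext => x; rewrite /fdiff.
pose u nu : R := (-1) ^+ nu * F (x + (k.+1%:R - nu%:R) * h).
transitivity (\sum_(0 <= nu < k.+2) 'C(k, nu)%:R * u nu +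
              \sum_(0 <= nu < k.+1) 'C(k, nu)%:R * u nu.+1).
  rewrite [in LHS]big_nat_recl// [in RHS]big_nat_recl// -addrA -big_split/=.
  congr (_ + _); first by rewrite /u !bin0 mulrA.
  apply: eq_bigr => nu _; rewrite binS natrD mulrDl mulrDl /u !mulrA.
  by [].
rewrite big_nat_recr//= bin_small// mul0r addr0 -big_split/=.
apply: eq_bigr => nu _; rewrite /u -mulrDr -!mulrA; congr (_ * _).
rewrite exprS mulN1r mulNr -mulrBr; congr (_ * (F _ - F _)).
  by rewrite -addrA -[X in _ = x + (_ + X)]mul1r -mulrDl addrAC natr1.
by rewrite -!natr1 opprD addrACA subrr addr0.
Qed.

Lemma fdiffD k l h F : fdiff (k + l) h F = fdiff k h (fdiff l h F).
Proof.
by elim: l F => [|l IH] F; rewrite ?addn0 ?fdiff0// addnS !fdiffS IH.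
Qed.

Lemma fdiffZ k h c F : fdiff k h (fun y => c * F y) = fun x => c * fdiff k h F x.
Proof.
apply/funext => x; rewrite /fdiff mulr_sumr; apply: eq_bigr => nu _.
by rewrite mulrCA.
Qed.

Lemma fdiff_step0 k F : (0 < k)%N -> fdiff k 0 F = fun=> 0.
Proof.
case: k => // k _; rewrite fdiffS; apply/funext => x.
by rewrite /fdiff big1// => nu _; rewrite addr0 subrr mulr0.
Qed.

Lemma is_derive_fdiff k h F F' : (forall x, is_derive x 1 F (F' x)) ->
  forall x, is_derive x 1 (fdiff k h F) (fdiff k h F' x).
Proof.
elim: k F F' => [|k IH] F F' dF x; first by rewrite !fdiff0.
rewrite !fdiffS; apply: (IH _ (fun y => F' (y + h) - F' y)) => {}x.
have d2 : is_derive x 1 (F \o shift h) (F' (x + h) * 1).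
  exact: (@is_derive1_comp R F (shift h) x _ _ (dF (x + h)) (is_derive_shift x 1 h)).
rewrite mulr1 in d2.
exact: (is_deriveB d2 (dF x)).
Qed.

Lemma continuous_fdiff k h F : continuous F -> continuous (fdiff k h F).
Proof.
elim: k F => [|k IH] F cF; first by rewrite fdiff0.
rewrite fdiffS; apply: IH => x; apply: cvgB; last exact: cF.
apply: (@continuous_comp _ _ _ (fun y => y + h) F); last exact: cF.
by apply: cvgD; [exact: cvg_id|exact: cvg_cst].
Qed.

Lemma measurable_shift h F :
  measurable_fun [set: R] F -> measurable_fun [set: R] (fun x => F (x + h)).
Proof.
move=> mF; have := measurable_comp_affine 1 h mF.
by under eq_fun do rewrite mul1r.
Qed.

Lemma measurable_fdiff k h F :
  measurable_fun [set: R] F -> measurable_fun [set: R] (fdiff k h F).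
Proof.
elim: k F => [|k IH] F cF; first by rewrite fdiff0.
rewrite fdiffS; apply: IH; apply: measurable_funB => //.
exact: measurable_shift.
Qed.

Lemma periodic_fdiff k h F : periodic F 1 -> periodic (fdiff k h F) 1.
Proof.
elim: k F => [|k IH] F pF; first by rewrite fdiff0.
by rewrite fdiffS; apply: IH => x; rewrite addrAC !pF.
Qed.

Lemma ae_fdiff k h (f g : R -> R) : {ae mu, forall x, f x = g x} ->
  {ae mu, forall x, fdiff k h f x = fdiff k h g x}.
Proof.
elim: k f g => [|k IH] f g fg; first by rewrite !fdiff0.
rewrite !fdiffS; apply: IH.
have := ae_affine h ltr01 fg; move: fg.
apply: (@filterS2 _ (almost_everywhere mu) _ (fun x => f x = g x)) => x.
by rewrite mul1r => -> ->.
Qed.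

Lemma periodic_average a F : periodic F 1 -> periodic (average a F) 1.
Proof.
move=> pF x; rewrite /average; apply: eq_Rintegral => t _.
by rewrite addrAC pF.
Qed.

Lemma locint_affine a b c d F : 0 <= a -> locint F ->
  mu.-integrable `[c, d] (EFin \o (fun t => F (a * t + b))).
Proof.
move=> a0 [mF iF].
have mFa : measurable_fun [set: R] (fun t => F (a * t + b)).
  exact: measurable_comp_affine.
move: a0; rewrite le_eqVlt => /predU1P[<-|a0].
  apply: continuous_compact_integrable; first exact: segment_compact.
  have -> : (fun t => F (0 * t + b)) = cst (F b).
    by apply/funext => t; rewrite mul0r add0r.
  by apply: continuous_subspaceT => x; exact: cvg_cst.
apply/integrableP; split; first exact/measurable_EFinP/measurable_funTS.
have /integrableP[_] := iF (a * c + b) (a * d + b).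
rewrite (@ge0_integral_affine _ a b)//; last first.
  by apply: measurableT_comp => //; exact/measurable_EFinP.
rewrite (_ : (fun x => a * x + b) @^-1` _ = `[c, d]%classic); last first.
  by apply/seteqP; split => x /=; rewrite !in_itv/= !lerD2r !ler_pM2l.
by move: (integral _ _ _) => -[r| |]//; rewrite ?ltry// gt0_muley.
Qed.

Lemma locint_average_integrable a x F : 0 <= a -> locint F ->
  mu.-integrable `[0, 1] (EFin \o (fun t => F (x + a * t))).
Proof.
move=> a0 lF; have := locint_affine x 0 1 a0 lF.
by rewrite (_ : (fun t => F (x + a * t)) = fun t => F (a * t + x))//;
  apply/funext => t; rewrite addrC.
Qed.

Lemma Rintegral_lincomb (I : Type) (s : seq I) (c : I -> R) (G : I -> R -> R)
    (D : set R) : measurable D ->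
  (forall i, mu.-integrable D (EFin \o G i)) ->
  \int[mu]_(t in D) (\sum_(i <- s) c i * G i t) =
  \sum_(i <- s) c i * \int[mu]_(t in D) G i t.
Proof.
move=> mD iG.
have iZ i : mu.-integrable D (EFin \o (fun t => c i * G i t)).
  rewrite (_ : _ \o _ = (fun t => (c i)%:E * (EFin \o G i) t)%E).
    by apply: integrableZl.
  by apply/funext => t.
suff H : mu.-integrable D (EFin \o (fun t => \sum_(i <- s) c i * G i t)) /\
  \int[mu]_(t in D) (\sum_(i <- s) c i * G i t) =
  \sum_(i <- s) c i * \int[mu]_(t in D) G i t by case: H.
elim: s => [|i s [iS E]].
  split; last first.
    rewrite big_nil; under eq_Rintegral do rewrite big_nil.
    by rewrite /Rintegral integral0.
  rewrite (_ : _ \o _ = cst 0%E); first exact: integrable0.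
  by apply/funext => t /=; rewrite big_nil.
split.
  rewrite (_ : _ \o _ = (EFin \o (fun t => c i * G i t)%R) \+
      (EFin \o (fun t => \sum_(i <- s) c i * G i t)%R))%E.
    by apply: integrableD.
  by apply/funext => t /=; rewrite big_cons EFinD.
under eq_Rintegral do rewrite big_cons.
by rewrite big_cons RintegralD// E RintegralZl.
Qed.

Lemma continuous_sum (I : Type) (r : seq I) (F : I -> R -> R) :
  (forall i, continuous (F i)) -> continuous (fun x => \sum_(i <- r) F i x).
Proof.
move=> cF; elim: r => [|i r IH] x.
  rewrite (_ : (fun y => _) = cst 0); first exact: cvg_cst.
  by apply/funext => y; rewrite big_nil.
rewrite (_ : (fun y => _) = F i + fun y => \sum_(j <- r) F j y).
  by apply: cvgD; [exact: cF|exact: IH].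
by apply/funext => y; rewrite big_cons.
Qed.


Lemma is_derive_sumf (I : Type) (r : seq I) (F F' : I -> R -> R) (x : R) :
  (forall i, is_derive x 1 (F i) (F' i x)) ->
  is_derive x 1 (fun y => \sum_(i <- r) F i y) (\sum_(i <- r) F' i x).
Proof.
move=> dF; elim: r => [|i r IH].
  rewrite big_nil (_ : (fun y => _) = cst 0); first exact: is_derive_cst.
  by apply/funext => y; rewrite big_nil.
rewrite big_cons (_ : (fun y => _) = F i + fun y => \sum_(j <- r) F j y).
  exact: is_deriveD.
by apply/funext => y; rewrite big_cons.
Qed.


Lemma is_derive_mull (c : R) F (x : R) (df : R) :
  is_derive x 1 F df -> is_derive x 1 (fun y => c * F y) (c * df).
Proof.
move=> dF; have d : is_derive x 1 (c *: F) (c *: df) by exact: is_deriveZ.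
exact: d.
Qed.

End FiniteDifference.

(** * Smooth approximation controlled by the modulus of smoothness *)

Section SmoothApproximation.
Context {R : realType}.
Local Notation mu := (@lebesgue_measure R).
Variables (p d : R) (s : nat) (f : R -> R) (M : \bar R).
Hypotheses (p1 : 1 <= p) (d0 : 0 < d) (s0 : (0 < s)%N).
Hypotheses (lf : locint f) (pf : periodic f 1).
Hypothesis fM : forall h, 0 < h < d -> (Lpnorm p (fdiff s h f) <= M)%E.
Hypothesis M0 : (0 <= M)%E.

Let p0 : 0 < p. Proof. exact: lt_le_trans p1. Qed.

(** With this step, all the difference steps that occur below stay under [d]: they
    are at most [(s + 1) base_step] in [averaged_difference], and [s base_step] in the
    derivatives of the approximant. *)
Definition base_step : R := d / s.+2%:R.

Lemma base_step_gt0 : 0 < base_step.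
Proof. by rewrite divr_gt0. Qed.

(** The width of the means that replace [f] at distance [s - nu] steps; it vanishes
    for [nu = s], where [f] is left as it is. *)
Definition dilation (nu : nat) : R := (s%:R - nu%:R) * base_step.

Lemma dilation_gt0 nu : (nu < s)%N -> 0 < dilation nu.
Proof. by move=> nus; rewrite mulr_gt0 ?base_step_gt0// subr_gt0 ltr_nat. Qed.

Lemma dilation_ge0 nu : (nu <= s)%N -> 0 <= dilation nu.
Proof. by move=> nus; rewrite mulr_ge0 ?(ltW base_step_gt0)// subr_ge0 ler_nat. Qed.

Lemma dilation_lt nu : dilation nu < d.
Proof.
rewrite /dilation /base_step mulrCA -[X in _ < X]mulr1 ltr_pM2l//.
rewrite ltr_pdivrMr// mul1r ltrBlDr (lt_le_trans (y := s.+2%:R))//.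
  by rewrite ltr_nat.
by rewrite lerDl.
Qed.

Lemma base_step_le_dilation nu : (nu < s)%N -> base_step <= dilation nu.
Proof.
move=> nus; rewrite /dilation ler_peMl ?(ltW base_step_gt0)//.
by rewrite lerBrDr nat1r ler_nat.
Qed.

Definition iter_average m nu : R -> R := iter m (average (dilation nu)) f.

Local Arguments iter_average : simpl never.

Lemma locint_iter_average m nu : (nu <= s)%N -> locint (iter_average m nu).
Proof.
move=> nus; elim: m => // m IH; rewrite /iter_average iterS -/(iter_average m nu).
have := dilation_ge0 nus; rewrite le_eqVlt => /predU1P[<-|w0].
  by rewrite average0.
by apply: continuous_locint; exact: continuous_average.
Qed.

Lemma continuous_iter_average m nu : (nu < s)%N -> continuous (iter_average m.+1 nu).
Proof.
move=> nus; rewrite /iter_average iterS -/(iter_average m nu).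
by apply: continuous_average; [exact: dilation_gt0|exact/locint_iter_average/ltnW].
Qed.

Lemma periodic_iter_average m nu : periodic (iter_average m nu) 1.
Proof. by elim: m => // m IH; rewrite /iter_average iterS; exact: periodic_average. Qed.

Definition diff_coef nu : R := 'C(s, nu)%:R * (-1) ^+ nu.

(** The mean of [fdiff s (v + base_step * (t_1 + ... + t_m)) f x] over [t] in the unit
    cube of dimension [m], after each mean has been moved onto the corresponding
    value of [f]. *)
Definition averaged_difference m v x : R :=
  \sum_(nu < s.+1) diff_coef nu * iter_average m nu (x + (s%:R - nu%:R) * v).

Lemma measurable_averaged_difference m v : measurable_fun [set: R] (averaged_difference m v).
Proof.
apply: measurable_sum => nu; apply: measurable_funM => //.
by apply: measurable_shift; have [] := @locint_iter_average m nu (leq_ord nu).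
Qed.

(** A change of [base_step * t] in [v] displaces the term of index [nu] by
    [dilation nu * t], so one mean over [t] is one more average of that term. *)
Lemma averaged_differenceS m v x :
  averaged_difference m.+1 v x =
  \int[mu]_(t in `[0, 1]) averaged_difference m (v + base_step * t) x.
Proof.
have E (nu : 'I_s.+1) t : x + (s%:R - nu%:R) * (v + base_step * t) =
    x + (s%:R - nu%:R) * v + dilation nu * t.
  by rewrite /dilation mulrDr addrA mulrA.
rewrite /averaged_difference Rintegral_lincomb//.
  apply: eq_bigr => nu _; congr (_ * _).
  rewrite /iter_average iterS {1}/average; apply: eq_Rintegral => t _.
  by rewrite E.
move=> nu.
have := locint_average_integrable (x + (s%:R - nu%:R) * v)
  (dilation_ge0 (leq_ord nu)) (@locint_iter_average m nu (leq_ord nu)).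
congr (_.-integrable _ _); apply/funext => t /=.
by rewrite E.
Qed.

Lemma averaged_difference0 v : averaged_difference 0 v = fdiff s v f.
Proof. by apply/funext => x; rewrite /fdiff big_mkord. Qed.

Lemma Lpnorm_averaged_difference m v : 0 <= v -> v + m%:R * base_step < d ->
  (Lpnorm p (averaged_difference m v) <= M)%E.
Proof.
elim: m v => [|m IH] v v0 vd.
  rewrite averaged_difference0; move: v0 vd; rewrite le_eqVlt mul0r addr0.
  move=> /predU1P[<- _|v0 vd]; first by rewrite fdiff_step0// Lpnorm0.
  by apply: fM; rewrite v0.
apply: (@Lpnorm_average _ p (fun t => averaged_difference m (v + base_step * t))) => //.
- apply: measurable_sum => nu; apply: measurable_funM => //.
  apply: (@measurableT_comp _ _ _ _ _ _ (iter_average m nu)).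
    by have [] := @locint_iter_average m nu (leq_ord nu).
  apply: measurable_funD => //; apply: measurable_funM => //.
  by apply: measurable_funD => //; exact: measurable_funM.
- exact: measurable_averaged_difference.
- by move=> x; exact: averaged_differenceS.
- move=> t; rewrite in_itv/= => /andP[t0 t1]; apply: IH.
    by rewrite addr_ge0// mulr_ge0// ltW// base_step_gt0.
  apply: le_lt_trans vd; rewrite -addrA lerD2l -natr1 mulrDl mul1r addrC lerD2l.
  by rewrite ler_piMr// ltW// base_step_gt0.
Qed.

(** The case [i = 0] is the smooth approximant, and [approximant i] is its derivative of
    order [i] for [i <= s]: differentiating an average of width [a] gives a difference of step [a]
    divided by [a].  The [s + 1] averages leave one on the derivative of order [s], which
    is thus continuous and exists at every point. *)
Definition approximant i x : R :=
  - (-1) ^+ s * \sum_(nu < s) diff_coef nu * ((dilation nu) ^- i *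
     fdiff i (dilation nu) (iter_average (s.+1 - i) nu) x).

Lemma periodic_approximant i : periodic (approximant i) 1.
Proof.
move=> x; congr (_ * _); apply: eq_bigr => nu _; congr (_ * (_ * _)).
by apply: periodic_fdiff; exact: periodic_iter_average.
Qed.

Lemma continuous_approximant i : (i <= s)%N -> continuous (approximant i).
Proof.
move=> iles x; apply: cvgM; first exact: cvg_cst.
move: x; apply: continuous_sum => nu x.
apply: cvgM; first exact: cvg_cst.
apply: cvgM; first exact: cvg_cst.
by move: x; apply: continuous_fdiff; rewrite subSn//; exact: continuous_iter_average.
Qed.

Lemma is_derive_approximant i (x : R) : (i < s)%N ->
  is_derive x 1 (approximant i) (approximant i.+1 x).
Proof.
move=> ltis; rewrite /approximant.
apply: is_derive_mull.
pose term k (nu : 'I_s) y := diff_coef nu * (dilation nu ^- k *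
  fdiff k (dilation nu) (iter_average (s.+1 - k) nu) y).
apply: (@is_derive_sumf _ _ _ (term i) (term i.+1)) => nu; rewrite /term.
apply: is_derive_mull.
have w0 := dilation_gt0 (ltn_ord nu).
have -> : dilation nu ^- i.+1 * fdiff i.+1 (dilation nu) (iter_average (s.+1 - i.+1) nu) x =
  dilation nu ^- i * fdiff i (dilation nu) (fun y => (dilation nu)^-1 *
    (iter_average (s - i) nu (y + dilation nu) - iter_average (s - i) nu y)) x.
  by rewrite fdiffZ fdiffS subSS exprSr invfM -mulrA.
apply: is_derive_mull.
apply: is_derive_fdiff => {}x.
rewrite subSn ?(ltnW ltis)// /iter_average iterS; apply: is_derive_average => //.
rewrite -/(iter_average (s - i) nu) -(prednK (n := s - i)) ?subn_gt0//.
exact: continuous_iter_average.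
Qed.

(** In the averaged difference at [v = 0] the term of index [s] is [f] up to sign, and
    the other terms sum up to the approximant. *)
Lemma approximant_error : (Lpnorm p (f \- approximant 0)%R <= M)%E.
Proof.
have -> : f \- approximant 0 = fun x => (-1) ^+ s * averaged_difference s.+1 0 x.
  apply/funext => x /=; rewrite /approximant /averaged_difference big_ord_recr/= ?subn0.
  have -> : iter_average s.+1 s = f.
    have w0 : dilation s = 0 by rewrite /dilation subrr mul0r.
    by rewrite /iter_average w0; elim: s.+1 => // k IH; rewrite iterS IH average0.
  rewrite subrr mul0r addr0 /diff_coef binn mul1r mulrDr mulrA -expr2 sqrr_sign mul1r.
  rewrite addrC; congr (_ + _); rewrite -mulNr opprK; congr (_ * _).
  apply: eq_bigr => nu _.
  by rewrite expr0 invr1 mul1r mulr0 addr0 fdiff0.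
rewrite LpnormZ//; last exact: measurable_averaged_difference.
rewrite normrX normrN1 expr1n mul1e; apply: Lpnorm_averaged_difference => //.
by rewrite add0r /base_step mulrA ltr_pdivrMr// mulrC ltr_pM2l// ltr_nat.
Qed.

(** The remaining average commutes with the differences, so each term is a mean of
    translates of [fdiff s a f] with [base_step <= a < d]. *)
Lemma approximant_derivative_norm :
  (Lpnorm p (approximant s) <=
   ((\sum_(nu < s) 'C(s, nu)%:R) * base_step ^- s)%:E * M)%E.
Proof.
have mav m nu : (nu < s)%N -> measurable_fun [set: R] (iter_average m nu).
  by move=> nus; have [] := locint_iter_average m (ltnW nus).
have mfd (nu : 'I_s) : measurable_fun [set: R] (fdiff s (dilation nu) (iter_average (s.+1 - s) nu)).
  by apply: measurable_fdiff; exact: mav.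
rewrite /approximant LpnormZ//; last first.
  by apply: measurable_sum => nu; apply: measurable_funM => //; exact: measurable_funM.
rewrite normrN normrX normrN1 expr1n mul1e.
apply: le_trans (Lpnorm_sum _ p1 _) _.
  by move=> nu; apply: measurable_funM => //; exact: measurable_funM.
rewrite mulr_suml -sumEFin ge0_sume_distrl; last first.
  move=> nu _; rewrite lee_fin mulr_ge0// invr_ge0 exprn_ge0// ltW//.
  exact: base_step_gt0.
apply: lee_sum => nu _.
have w0 := dilation_gt0 (ltn_ord nu).
rewrite LpnormZ//; last exact: measurable_funM.
rewrite LpnormZ// muleA -EFinM.
have -> : `|diff_coef nu| = 'C(s, nu)%:R.
  by rewrite /diff_coef normrM normrX normrN1 expr1n mulr1 ger0_norm.
apply: lee_pmul.
- by rewrite lee_fin mulr_ge0.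
- exact: Lpnorm_ge0.
- rewrite lee_fin ler_wpM2l// ger0_norm ?invr_ge0 ?exprn_ge0 ?(ltW w0)//.
  rewrite lef_pV2 ?posrE ?exprn_gt0 ?base_step_gt0//.
  by rewrite lerXn2r ?nnegrE ?(ltW base_step_gt0) ?(ltW w0)// base_step_le_dilation.
- rewrite subSnn.
  apply: (@Lpnorm_average _ p (fun t x => fdiff s (dilation nu) f (x + dilation nu * t))) => //.
  + have mf : measurable_fun [set: R] (fdiff s (dilation nu) f).
      by apply: measurable_fdiff; have [] := lf.
    apply: (measurableT_comp mf).
    by apply: measurable_funD => //; exact: measurable_funM.
  + by have := mfd nu; rewrite subSnn.
  + move=> x; rewrite /fdiff Rintegral_lincomb//.
      apply: eq_bigr => k _; congr (_ * _); rewrite /iter_average/= /average.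
      by apply: eq_Rintegral => t _; rewrite addrAC.
    move=> k.
    have := locint_average_integrable (x + (s%:R - k%:R) * dilation nu) (ltW w0) lf.
    congr (_.-integrable _ _); apply/funext => t /=.
    by rewrite addrAC.
  + move=> t t01; rewrite Lpnorm_shift//.
    * by apply: fM; rewrite w0 dilation_lt.
    * by apply: measurable_fdiff; have [] := lf.
    * exact: periodic_fdiff.
Qed.

End SmoothApproximation.

(** * Differences of smooth functions *)

Section DifferenceBounds.
Context {R : realType}.
Local Notation mu := (@lebesgue_measure R).
Implicit Types (h x y lo hi B : R) (F : R -> R) (D : nat -> R -> R).

(** Successive derivatives are kept as an explicit sequence, a form which is stable
    under translation and subtraction. *)
Definition derivatives k D :=
  forall i, (i < k)%N -> forall x : R, is_derive x 1 (D i) (D i.+1 x).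

Lemma derivatives_continuous k D i : derivatives k D -> (i < k)%N ->
  continuous (D i).
Proof.
move=> dD ik x; apply: differentiable_continuous; apply/derivable1_diffP.
by have [] := dD i ik x.
Qed.

Lemma derivatives_shiftB k h D : derivatives k D ->
  derivatives k (fun i y => D i (y + h) - D i y).
Proof.
move=> dD i ik x.
have d2 : is_derive x 1 (D i \o shift h) (D i.+1 (x + h) * 1).
  exact: (@is_derive1_comp R (D i) (shift h) x _ _ (dD i ik (x + h))
    (is_derive_shift x 1 h)).
rewrite mulr1 in d2.
exact: (is_deriveB d2 (dD i ik x)).
Qed.

Lemma derive1n_derivatives k D : derivatives k D ->
  forall i, (i <= k)%N -> (D 0)^`(i)%classic = D i.
Proof.
move=> dD; elim=> // i IH ik; rewrite derive1nS IH ?(ltnW ik)//.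
apply/funext => x; rewrite derive1E.
by have [_ ->] := dD i ik x.
Qed.

Lemma fdiff_le k h F x B :
  (forall j, (j <= k)%N -> `|F (x + j%:R * h)| <= B) ->
  `|fdiff k h F x| <= 2 ^+ k * B.
Proof.
elim: k F B => [|k IH] F B FB.
  by rewrite fdiff0 mul1r; have := FB 0 isT; rewrite mul0r addr0.
rewrite fdiffS exprSr -mulrA; apply: IH => j jk.
rewrite [2 * B]mulr_natl mulr2n; apply: (le_trans (ler_normB _ _)); apply: lerD.
  by rewrite -addrA -[X in _ + (_ + X)]mul1r -mulrDl natr1; exact: FB.
by apply: FB; exact: leqW.
Qed.

Lemma mean_value_le F F' lo hi B :
  (forall x : R, is_derive x 1 F (F' x)) ->
  (forall y, lo <= y <= hi -> `|F' y| <= B) ->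
  forall a b, lo <= a <= hi -> lo <= b <= hi -> `|F b - F a| <= `|b - a| * B.
Proof.
move=> dF FB a b; wlog ab : a b / a <= b => [H|].
  by case/orP: (le_total a b) => ab ha hb; [|rewrite distrC [`|b - a|]distrC]; apply: H.
move=> /andP[loa _] /andP[_ bhi].
have cF : {within `[a, b], continuous F}.
  apply: derivable_within_continuous => x _.
  by have [] := dF x.
have [c cab ->] := MVT_segment ab (fun x _ => dF x) cF.
rewrite normrM mulrC ler_wpM2l//; apply: FB.
by move: cab; rewrite in_itv/= => /andP[/(le_trans loa) -> /le_trans ->].
Qed.

Lemma between_step k h x lo hi y :
  lo <= x <= hi -> lo <= x + k.+1%:R * h <= hi ->
  Num.min x (x + k%:R * h) <= y <= Num.max x (x + k%:R * h) ->
  (lo <= y <= hi) /\ (lo <= y + h <= hi).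
Proof.
rewrite -natr1 mulrDl mul1r addrA => /andP[x1 x2] /andP[h1 h2].
have kh0 (a : R) : 0 <= a -> 0 <= k%:R * a by move=> ?; rewrite mulr_ge0.
have [h0|h0] := leP 0 h.
  have := kh0 _ h0 => k0.
  rewrite min_l ?max_r ?lerDl// => /andP[y1 y2].
  by split; apply/andP; split; lra.
have := kh0 (- h); rewrite oppr_ge0 mulrN => /(_ (ltW h0)) k0.
rewrite min_r ?max_l ?gerDl; [|lra..] => /andP[y1 y2].
by split; apply/andP; split; lra.
Qed.

Lemma min_max_ends k h x : let lo := Num.min x (x + k%:R * h) in
  let hi := Num.max x (x + k%:R * h) in
  (lo <= x <= hi) && (lo <= x + k%:R * h <= hi).
Proof. by rewrite /= !ge_min !le_max !lexx ?orbT. Qed.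

(** By [fdiffS], a difference of order [k + 1] of [D 0] is one of order [k] of an
    increment, whose derivative of order [k] is bounded by the mean value theorem. *)
Lemma fdiff_derive_le k h D x lo hi B : derivatives k D ->
  lo <= x <= hi -> lo <= x + k%:R * h <= hi ->
  (forall y, lo <= y <= hi -> `|D k y| <= B) ->
  `|fdiff k h (D 0) x| <= `|h| ^+ k * B.
Proof.
elim: k D x lo hi B => [|k IH] D x lo hi B dD x1 x2 DB.
  by rewrite fdiff0 mul1r; exact: DB.
rewrite fdiffS exprSr -mulrA.
have /andP[e1 e2] := min_max_ends k h x.
apply: (IH (fun i y => D i (y + h) - D i y) x _ _ _ _ e1 e2).
  by apply: derivatives_shiftB => i ik; apply: dD; exact: ltnW.
move=> y /(between_step x1 x2)[y1 y2].
rewrite -[X in `|X| * _](addrK y) [h + y]addrC.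
by apply: (mean_value_le (dD k (ltnSn k)) DB).
Qed.

Lemma increment_le_integral F F' lo hi a b :
  (forall x : R, is_derive x 1 F (F' x)) -> continuous F' ->
  lo <= a <= hi -> lo <= b <= hi ->
  `|F b - F a| <= \int[mu]_(y in `[lo, hi]) `|F' y|.
Proof.
move=> dF cF'; wlog ab : a b / a <= b => [H|].
  by case/orP: (le_total a b) => ab ha hb; [|rewrite distrC]; apply: H.
move=> /andP[loa ahi] /andP[lob bhi].
have cN : continuous (fun y => `|F' y|).
  by move=> y; apply: cvg_norm; exact: cF'.
have [_ iN] := continuous_locint cN.
have [_ iF'] := continuous_locint cF'.
have le2 : \int[mu]_(y in `[a, b]) `|F' y| <= \int[mu]_(y in `[lo, hi]) `|F' y|.
  apply: fine_le; [by apply: integrable_fin_num => //; exact: iN..|].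
  apply: ge0_subset_integral => //.
  - by apply: measurable_funTS; apply/measurable_EFinP; exact: continuous_measurable_fun.
  - by move=> y /=; rewrite !in_itv/= => /andP[/(le_trans loa) -> /le_trans ->].
apply: le_trans le2; move: ab; rewrite le_eqVlt => /predU1P[->|ab].
  by rewrite subrr normr0; apply: Rintegral_ge0.
have E : \int[mu]_(y in `[a, b]) F' y = F b - F a.
  rewrite /Rintegral (continuous_FTC2 (F := F) ab) ?EFinB//.
  - exact: continuous_subspaceT.
  - have cF : continuous F.
      move=> y; apply: differentiable_continuous; apply/derivable1_diffP.
      by have [] := dF y.
    split; first by move=> y _; have [] := dF y.
    + by apply: cvg_at_right_filter; exact: cF.
    + by apply: cvg_at_left_filter; exact: cF.
  - by move=> y _; rewrite derive1E; have [_ ->] := dF y.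
by rewrite -E; apply: le_normr_Rintegral => //; exact: iF'.
Qed.

(** One of the differences is spent on the fundamental theorem of calculus, the
    other [k] give a factor [h] each. *)
Lemma fdiff_integral_le k h D x lo hi : derivatives k.+1 D ->
  continuous (D k.+1) ->
  lo <= x <= hi -> lo <= x + k.+1%:R * h <= hi ->
  `|fdiff k.+1 h (D 0) x| <= `|h| ^+ k * \int[mu]_(y in `[lo, hi]) `|D k.+1 y|.
Proof.
move=> dD cD x1 x2; rewrite fdiffS.
have /andP[e1 e2] := min_max_ends k h x.
apply: (fdiff_derive_le (D := fun i y => D i (y + h) - D i y) _ e1 e2).
  by apply: derivatives_shiftB => i ik; apply: dD; exact: ltnW.
move=> y /(between_step x1 x2)[y1 y2].
exact: (increment_le_integral (dD k (ltnSn k)) cD).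
Qed.

End DifferenceBounds.

(** * The generalized Steklov average *)

Section Steklov.
Context {R : realType}.
Local Notation mu := (@lebesgue_measure R).
Local Notation leb := (@completed_lebesgue_measure R).
Implicit Types (h x : R) (f g F : R -> R) (r : nat).

Definition ratio r nu : R := (r%:R - nu%:R) / r%:R.

Lemma ratio_gt0 r nu : (nu < r)%N -> 0 < ratio r nu.
Proof.
move=> nur; rewrite divr_gt0 ?subr_gt0 ?ltr_nat// ltr0n.
exact: leq_ltn_trans nur.
Qed.

Lemma ratio_le1 r nu : (nu < r)%N -> ratio r nu <= 1.
Proof.
move=> nur; rewrite ler_pdivrMr ?mul1r ?gerBl// ltr0n.
exact: leq_ltn_trans nur.
Qed.

Lemma ratioV_le r nu : (nu < r)%N -> (ratio r nu)^-1 <= r%:R.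
Proof.
move=> nur; have r0 : 0 < r%:R :> R by rewrite ltr0n; exact: leq_ltn_trans nur.
have rnu : 1 <= r%:R - nu%:R :> R by rewrite lerBrDr nat1r ler_nat.
by rewrite invf_div ler_pdivrMr ?(lt_le_trans ltr01)// ler_peMr// ltW.
Qed.

Definition dilated_integral h r F x (nu : nat) : R :=
  \int[mu]_(t in `[- (h / 2), h / 2]) F (x + ratio r nu * t).

Lemma dilated_integrable h r F x (nu : 'I_r) : locint F ->
  mu.-integrable `[- (h / 2), h / 2] (EFin \o (fun t => F (x + ratio r nu * t))).
Proof.
move=> lF; have := locint_affine x (- (h / 2)) (h / 2)
  (ltW (ratio_gt0 (ltn_ord nu))) lF.
by congr (_.-integrable _ _); apply/funext => t /=; rewrite addrC.
Qed.

(** The integrals do not see null sets, so the average of [f] can be computed from a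
    locally integrable Borel function [F]. *)
Lemma steklovE h r f F x : locint F -> {ae mu, forall x, f x = F x} ->
  steklov h r f x = (-1) ^+ r.+1 * ('C(2 * r, r)%:R)^-1 * (2 / h) *
   \sum_(nu < r) (-1) ^+ nu * 'C(2 * r, nu)%:R * dilated_integral h r F x nu.
Proof.
move=> lF fF; rewrite /steklov; congr (_ * _).
rewrite -Rintegral_lincomb//; last by move=> nu; exact: dilated_integrable.
have mF : measurable_fun [set: R] F by have [] := lF.
rewrite /Rintegral; congr fine; apply: ae_integral_completed => //.
  apply: measurable_sum => nu; apply: measurable_funM => //.
  have := measurable_comp_affine (ratio r nu) x mF.
  by congr measurable_fun; apply/funext => t; rewrite addrC.
suff H (s : seq nat) : {subset s <= [pred nu | (nu < r)%N]} ->
    {ae mu, forall t,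
      \sum_(nu <- s) (-1) ^+ nu * 'C(2 * r, nu)%:R *
        f (x + (r%:R - nu%:R) / r%:R * t) =
      \sum_(nu <- s) (-1) ^+ nu * 'C(2 * r, nu)%:R * F (x + ratio r nu * t)}.
  have := H (index_iota 0 r).
  have sub : {subset index_iota 0 r <= [pred nu | (nu < r)%N]}.
    by move=> nu; rewrite mem_index_iota inE.
  move=> /(_ sub); apply: (filterS (F := almost_everywhere mu)) => t ->.
  by rewrite big_mkord.
elim: s => [_|nu s IH sub].
  by apply: aeW => t; rewrite !big_nil.
have nur : (nu < r)%N by have := sub nu; rewrite !inE eqxx; exact.
have {}IH : {ae mu, forall t,
      \sum_(nu <- s) (-1) ^+ nu * 'C(2 * r, nu)%:R *
        f (x + (r%:R - nu%:R) / r%:R * t) =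
      \sum_(nu <- s) (-1) ^+ nu * 'C(2 * r, nu)%:R * F (x + ratio r nu * t)}.
  by apply: IH => k ks; apply: sub; rewrite inE ks orbT.
move: (ae_affine x (ratio_gt0 nur) fF) IH.
apply: (@filterS2 _ (almost_everywhere mu)) => t ft IHt.
by rewrite !big_cons IHt addrC -/(ratio r nu) -[in LHS](addrC (_ * t)) ft addrC
  [in RHS](addrC x).
Qed.

Lemma locintB F G : locint F -> locint G -> locint (F \- G).
Proof.
move=> [mF iF] [mG iG]; split; first exact: measurable_funB.
move=> a b; rewrite (_ : _ \o _ = (EFin \o F) \- (EFin \o G))%E//.
by apply: integrableB.
Qed.

Lemma steklovB h r f g F G x : locint F -> locint G ->
  {ae mu, forall x, f x = F x} -> {ae mu, forall x, g x = G x} ->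
  steklov h r (f \- g) x = steklov h r f x - steklov h r g x.
Proof.
move=> lF lG fF gG.
have lFG : locint (F \- G) by exact: locintB.
have fgFG : {ae mu, forall x, (f \- g) x = (F \- G) x}.
  move: fF gG; apply: (@filterS2 _ (almost_everywhere mu)) => t.
  by move=> /= -> ->.
rewrite (steklovE _ _ _ lFG fgFG) (steklovE _ _ _ lF fF) (steklovE _ _ _ lG gG).
rewrite -mulrBr -sumrB; congr (_ * _); apply: eq_bigr => nu _.
rewrite -mulrBr; congr (_ * _).
by rewrite /dilated_integral -RintegralB//; exact: dilated_integrable.
Qed.

(** The substitution [y = x + ratio r nu * t] maps the interval of integration into
    the one around [x], at the price of the factor [(ratio r nu)^-1 <= r]. *)
Lemma steklov_le h r f F x : 0 < h -> locint F ->
  {ae mu, forall x, f x = F x} ->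
  (`|steklov h r f x|%:E <=
   ((2 * r%:R * \sum_(nu < r) 'C(2 * r, nu)%:R) / h)%:E *
   \int[mu]_(y in `[(x - h / 2)%R, (x + h / 2)%R]) (`|F y|)%:E)%E.
Proof.
move=> h0 lF fF; have mF : measurable_fun [set: R] F by have [] := lF.
set J := integral _ _ _.
have J0 : (0 <= J)%E by apply: integral_ge0 => y _; rewrite lee_fin.
have nJ (nu : 'I_r) : (`|dilated_integral h r F x nu|%:E <= r%:R%:E * J)%E.
  have r0 := ratio_gt0 (ltn_ord nu).
  apply: le_trans (abs_Rintegral_le _ _) _ => //.
    have := measurable_comp_affine (ratio r nu) x mF.
    by congr measurable_fun; apply/funext => t; rewrite addrC.
  have mN : measurable_fun [set: R] (fun y => (`|F y|)%:E).
    by apply/measurable_EFinP; exact: measurableT_comp.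
  have N0 y : (0 <= (`|F y|)%:E)%E by rewrite lee_fin.
  pose D : set R := `[x - ratio r nu * (h / 2), x + ratio r nu * (h / 2)]%classic.
  have mD : measurable D by exact: measurable_itv.
  have DE : (fun t => ratio r nu * t + x) @^-1` D = `[- (h / 2), h / 2]%classic.
    have e1 t : (x - ratio r nu * (h / 2) <= ratio r nu * t + x) = (- (h / 2) <= t).
      by rewrite -[RHS](ler_pM2l r0) mulrN addrC lerD2r.
    have e2 t : (ratio r nu * t + x <= x + ratio r nu * (h / 2)) = (t <= h / 2).
      by rewrite addrC lerD2l ler_pM2l.
    by apply/seteqP; split => t; rewrite /D/= !in_itv/= e1 e2.
  have E := ge0_integral_affine x r0 mD mN N0.
  rewrite DE in E.
  have DJ : (\int[mu]_(y in D) (`|F y|)%:E <= J)%E.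
    apply: ge0_subset_integral => //; first exact: measurable_funTS.
    have le1 : ratio r nu * (h / 2) <= h / 2.
      by rewrite ler_piMl ?ratio_le1// divr_ge0// ltW.
    move=> y; rewrite /D/= !in_itv/= => /andP[y1 y2].
    by apply/andP; split; lra.
  have -> : (\int[mu]_(t in `[(- (h / 2))%R, (h / 2)%R])
      (`|F (x + ratio r nu * t)|)%:E =
      (ratio r nu)^-1%:E * \int[mu]_(y in D) (`|F y|)%:E)%E.
    rewrite E muleA -EFinM mulVf ?gt_eqF// mul1e.
    by apply: eq_integral => t _; rewrite addrC.
  apply: (le_trans (lee_wpmul2l _ DJ)); first by rewrite lee_fin invr_ge0 ltW.
  by apply: lee_wpmul2r => //; rewrite lee_fin ratioV_le.
rewrite (steklovE _ _ _ lF fF) normrM.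
apply: (@le_trans _ _ ((2 / h)%:E * \sum_(nu < r) ('C(2 * r, nu)%:R%:E * (r%:R%:E * J)))%E).
  rewrite EFinM; apply: lee_pmul; rewrite ?lee_fin//.
    rewrite normrM [`|2 / h|]ger0_norm ?divr_ge0 ?(ltW h0)//.
    rewrite normrM normrX normrN1 expr1n mul1r ger0_norm ?invr_ge0//.
    rewrite ler_piMl ?divr_ge0 ?(ltW h0)//.
    by rewrite invf_le1 ?ler1n ?ltr0n bin_gt0 leq_pmull.
  apply: (@le_trans _ _ (\sum_(nu < r) `|(-1) ^+ nu * 'C(2 * r, nu)%:R *
      dilated_integral h r F x nu|)%:E); first by rewrite lee_fin ler_norm_sum.
  rewrite -sumEFin; apply: lee_sum => nu _.
  rewrite !normrM normrX normrN1 expr1n mul1r ger0_norm// EFinM.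
  by apply: lee_wpmul2l; [rewrite lee_fin|exact: nJ].
rewrite -ge0_sume_distrl; last by move=> nu _; rewrite lee_fin.
rewrite sumEFin !muleA -!EFinM; apply: lee_wpmul2r => //.
rewrite lee_fin le_eqVlt; apply/orP; left; apply/eqP.
by ring.
Qed.

End Steklov.

Section SteklovSmooth.
Context {R : realType}.
Local Notation mu := (@lebesgue_measure R).
Variables (r : nat) (h : R).
Hypotheses (r0 : (0 < r)%N) (h0 : 0 < h).
Implicit Types (x t : R) (g : R -> R).

Definition half_sum g x t : R :=
  \sum_(nu < r) (-1) ^+ nu * 'C(2 * r, nu)%:R * g (x + ratio r nu * t).

(** The symmetry of the binomial coefficients pairs the indices [nu] and [2 r - nu]. *)
Lemma central_difference g x t :
  fdiff (2 * r) (t / r%:R) g (x - t) =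
  half_sum g x t + (-1) ^+ r * 'C(2 * r, r)%:R * g x + half_sum g x (- t).
Proof.
have rn0 : r%:R != 0 :> R by rewrite pnatr_eq0 -lt0n.
pose e nu : R := (-1) ^+ nu * 'C(2 * r, nu)%:R * g (x + (r%:R - nu%:R) / r%:R * t).
transitivity (\sum_(0 <= nu < (2 * r).+1) e nu).
  apply: eq_bigr => nu _; rewrite /e [_ ^+ _ * _]mulrC; congr (_ * g _).
  by rewrite mul2n -addnn natrD; field.
have le1 : (r <= (2 * r).+1)%N by rewrite mul2n -addnn leqW// leq_addr.
rewrite (big_cat_nat (leq0n r) le1)/= /half_sum big_mkord -addrA; congr (_ + _).
rewrite big_ltn; last by rewrite ltnS mul2n -addnn leq_addr.
congr (_ + _); first by rewrite /e subrr mul0r mul0r addr0.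
rewrite -[in RHS](big_mkord xpredT (fun nu =>
  (-1) ^+ nu * 'C(2 * r, nu)%:R * g (x + ratio r nu * - t))).
rewrite -{1}[r.+1]add0n big_addn.
rewrite (_ : (2 * r).+1 - r.+1 = r)%N; last by rewrite subSS mul2n -addnn addnK.
rewrite big_nat_rev/=; apply: eq_big_nat => nu /andP[_ nur].
have E : (0 + r - nu.+1 + r.+1 = 2 * r - nu)%N.
  by rewrite add0n mul2n -addnn addnS -addSn -subSn// subSS -addnBAC// ltnW.
rewrite E /e; have nu2r : (nu <= 2 * r)%N by rewrite mul2n -addnn (leq_trans (ltnW nur))// leq_addr.
rewrite bin_sub//; congr (_ * _ * g _).
  by rewrite -signr_odd oddB// mul2n odd_double addFb signr_odd.
by rewrite /ratio natrB// mul2n -addnn natrD; field.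
Qed.

Lemma continuous_half_sum g x : continuous g -> continuous (half_sum g x).
Proof.
move=> cg; apply: continuous_sum => nu t.
apply: cvgM; first exact: cvg_cst.
apply: (@continuous_comp _ _ _ (fun t => x + ratio r nu * t) g); last exact: cg.
by apply: cvgD; [exact: cvg_cst|apply: cvgM; [exact: cvg_cst|exact: cvg_id]].
Qed.

(** The interval of integration is symmetric, so both halves of a central
    difference have the same integral: the deviation of the Steklov average is a mean of
    central differences of order [2 r]. *)
Lemma steklov_sub g x : continuous g ->
  steklov h r g x - g x = (-1) ^+ r.+1 * ('C(2 * r, r)%:R)^-1 * h^-1 *
    \int[mu]_(t in `[- (h / 2), h / 2]) fdiff (2 * r) (t / r%:R) g (x - t).
Proof.
move=> cg; have lg := continuous_locint cg.
have cT := @continuous_half_sum g x cg.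
have cTN : continuous (half_sum g x \o -%R).
  by move=> t; apply: continuous_comp; [exact: opp_continuous|exact: cT].
have [_ iT] := continuous_locint cT; have [_ iTN] := continuous_locint cTN.
rewrite (steklovE _ _ _ lg (ae_refl g)) -Rintegral_lincomb//; last first.
  by move=> nu; exact: dilated_integrable.
under [in RHS]eq_Rintegral do rewrite central_difference.
have c0 : mu.-integrable `[- (h / 2), h / 2]
    (EFin \o (fun=> (-1) ^+ r * 'C(2 * r, r)%:R * g x)).
  by apply: (continuous_locint _).2 => t; exact: cvg_cst.
have cTc : continuous (fun t => half_sum g x t +
    (-1) ^+ r * 'C(2 * r, r)%:R * g x).
  by move=> t; apply: cvgD; [exact: cT|exact: cvg_cst].
have [_ iTc] := continuous_locint cTc.
rewrite (RintegralD _ (iTc _ _) (iTN _ _))//.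
rewrite RintegralD//.
have -> : \int[mu]_(t in `[- (h / 2), h / 2]) half_sum g x (- t) =
    \int[mu]_(t in `[- (h / 2), h / 2]) half_sum g x t.
  congr fine.
  have := @integration_by_substitution_oppr _ (half_sum g x) (- (h / 2)) (h / 2).
  rewrite opprK; move=> <- //; last exact: continuous_subspaceT.
  by rewrite ge0_cp// divr_ge0// ltW.
rewrite Rintegral_cst//= lebesgue_measure_itv/= lte_fin.
have hh : - (h / 2) < h / 2 by have := h0; lra.
rewrite hh -EFinB/= -/(half_sum g x).
set I := \int[mu]_(t in _) _; set c : R := 'C(2 * r, r)%:R.
have c0' : c != 0 by rewrite pnatr_eq0 -lt0n bin_gt0 leq_pmull.
have h0' : h != 0 by rewrite gt_eqF.
have sg : (-1) ^+ r * (-1) ^+ r = 1 :> R by rewrite -expr2 sqrr_sign.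
rewrite exprS.
set e := (-1) ^+ r in sg *.
have alg (G : R) : -1 * e * c^-1 * (2 / h) * I - e * e * G =
    -1 * e * c^-1 * h^-1 * (I + e * c * G * (h / 2 - - (h / 2)) + I).
  by field; rewrite c0' h0'.
by have := alg (g x); rewrite sg mul1r.
Qed.

(** Of the [2 r] differences, [s] are turned into the integral of the derivative of
    order [s]; each of the others costs a factor 2. *)
Lemma steklov_sub_le (s : nat) (D : nat -> R -> R) x : (0 < s)%N -> (s <= 2 * r)%N ->
  derivatives s D -> continuous (D s) ->
  `|steklov h r (D 0) x - D 0 x| <= 2 ^+ (2 * r - s) * h ^+ s.-1 *
     \int[mu]_(y in `[x - h / 2, x + h / 2]) `|D s y|.
Proof.
case: s => // k _ kr dD cD; have cg := derivatives_continuous dD (ltn0Sn k).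
rewrite steklov_sub//.
set J := \int[mu]_(y in `[x - h / 2, x + h / 2]) `|D k.+1 y|; set K := _ * J.
have J0 : 0 <= J by apply: Rintegral_ge0 => y _; exact: normr_ge0.
have K0 : 0 <= K by rewrite !mulr_ge0 ?exprn_ge0 ?(ltW h0).
have Sle t : t \in `[- (h / 2), h / 2] ->
    `|fdiff (2 * r) (t / r%:R) (D 0) (x - t)| <= K.
  rewrite in_itv/= => /andP[t1 t2].
  rewrite -[X in fdiff X](subnK kr) fdiffD /K -mulrA; apply: fdiff_le => j jr.
  have rR : 0 < r%:R :> R by rewrite ltr0n.
  have rn0 : r%:R != 0 :> R by rewrite gt_eqF.
  have inI (i : nat) : (i <= 2 * r)%N ->
      x - h / 2 <= x - t + i%:R * (t / r%:R) <= x + h / 2.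
    move=> ir; have -> : x - t + i%:R * (t / r%:R) = x + (i%:R - r%:R) / r%:R * t by field.
    rewrite -ler_distl addrAC subrr add0r normrM.
    apply: (@le_trans _ _ (1 * `|t|)); last first.
      by rewrite mul1r ler_norml t1 t2.
    apply: ler_wpM2r => //; rewrite normrM normfV (ger0_norm (ltW rR)).
    rewrite ler_pdivrMr// mul1r ler_norml lerBrDr addrC subrr ler0n/=.
    by rewrite lerBlDr -natrD ler_nat addnn -mul2n.
  have x1 := inI j (leq_trans jr (leq_subr _ _)).
  have x2 : x - h / 2 <= x - t + j%:R * (t / r%:R) + k.+1%:R * (t / r%:R) <= x + h / 2.
    rewrite -addrA -mulrDl -natrD; apply: inI.
    by rewrite -(subnK kr) leq_add2r.
  apply: le_trans (fdiff_integral_le dD cD x1 x2) _; apply: ler_wpM2r => //.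
  rewrite lerXn2r ?nnegrE ?(ltW h0)// normrM normfV (ger0_norm (ltW rR)).
  rewrite ler_pdivrMr//; apply: (@le_trans _ _ (h / 2)).
    by rewrite ler_norml t1 t2.
  have : 1 <= r%:R :> R by rewrite ler1n.
  by move: h0 => ? ?; nra.
pose S t := fdiff (2 * r) (t / r%:R) (D 0) (x - t).
have mu_h : mu `[- (h / 2), h / 2]%classic = h%:E.
  rewrite lebesgue_measure_itv/= lte_fin -EFinB opprK -splitr.
  by rewrite (_ : - (h / 2) < h / 2)//; have := h0; lra.
have cS : continuous S.
  move=> t; rewrite /S; under eq_fun do rewrite central_difference.
  apply: cvgD; last first.
    apply: (@continuous_comp _ _ _ -%R (half_sum (D 0) x)).
      exact: opp_continuous.
    exact: continuous_half_sum.
  by apply: cvgD; [exact: continuous_half_sum|exact: cvg_cst].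
have [_ iS] := continuous_locint cS.
have IS : `|\int[mu]_(t in `[- (h / 2), h / 2]) S t| <= h * K.
  apply: le_trans (le_normr_Rintegral _ (iS _ _)) _ => //.
  have -> : h * K = \int[mu]_(t in `[- (h / 2), h / 2]) (cst K t).
    by rewrite Rintegral_cst//= mu_h mulrC.
  have cN : continuous (fun t => `|S t|).
    by move=> y; apply: cvg_norm; exact: cS.
  apply: le_Rintegral => //.
  - by have [_] := continuous_locint cN; exact.
  - by apply: (continuous_locint _).2 => t; exact: cvg_cst.
rewrite normrM; apply: (@le_trans _ _ (h^-1 * (h * K))); last first.
  by rewrite mulrA mulVf ?gt_eqF// mul1r.
apply: ler_pM => //; rewrite normrM (ger0_norm (x := h^-1)) ?invr_ge0 ?(ltW h0)//.
rewrite ler_piMl ?invr_ge0 ?(ltW h0)//.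
rewrite normrM normrX normrN1 expr1n mul1r ger0_norm ?invr_ge0//.
by rewrite invf_le1 ?ler1n ?ltr0n bin_gt0 leq_pmull.
Qed.

End SteklovSmooth.

(** * Discrete norms on separated nodes *)

Section Nodes.
Context {R : realType}.
Local Notation mu := (@lebesgue_measure R).
Implicit Types (p : R) (n : nat).

Lemma lpnorm_ge0 p n (X : 'I_n -> R) f : 0 <= lpnorm p X f.
Proof. exact: powR_ge0. Qed.

Lemma lpnorm_distC p n (X : 'I_n -> R) f g :
  lpnorm p X (f \- g) = lpnorm p X (g \- f).
Proof. by rewrite /lpnorm; under eq_bigr do rewrite distrC. Qed.

(** Minkowski's inequality for the counting measure on the natural numbers, applied
    to the sequence of values at the nodes extended by 0. *)
Lemma lpnormD p n (X : 'I_n -> R) f g : 1 <= p ->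
  lpnorm p X (f \+ g) <= lpnorm p X f + lpnorm p X g.
Proof.
move=> p1; have p0 : 0 < p by exact: lt_le_trans p1.
have pn0 : p != 0 by rewrite gt_eqF.
pose u (f : R -> R) (k : nat) : R :=
  if insub k is Some i then f (X i) else 0.
pose S (f : R -> R) : R := \sum_(k < n) `|f (X k)| `^ p.
have S0 F : 0 <= S F by apply: sumr_ge0 => k _; exact: powR_ge0.
have uE F : ('N[counting]_(p%:E)[EFin \o u F] = (S F `^ p^-1)%:E)%E.
  rewrite Lnorm_counting// -poweR_EFin; congr (_ `^ _)%E.
  rewrite (nneseries_split 0 n); last first.
    by move=> k _; exact: poweR_ge0.
  rewrite add0n eseries0 ?adde0; last first.
    move=> k nk _; rewrite /u /= insubN; first by rewrite normr0 powR0.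
    by rewrite -leqNgt.
  rewrite big_mkord -sumEFin; apply: eq_bigr => k _.
  by rewrite /u /= valK.
have lE F : lpnorm p X F = n%:R^-1 `^ p^-1 * S F `^ p^-1.
  by rewrite /lpnorm powRM ?invr_ge0//; exact: S0.
rewrite !lE -mulrDr ler_wpM2l ?powR_ge0//.
have uD : u (f \+ g) = (u f \+ u g)%R.
  by apply/funext => k; rewrite /u /=; case: insub => //=; rewrite addr0.
have mu_ F : measurable_fun [set: nat] (u F) by [].
have := minkowski_EFin counting (mu_ f) (mu_ g) p1.
by rewrite -uD (uE (f \+ g)) (uE f) (uE g) -EFinD lee_fin.
Qed.

Lemma lpnorm_triangle p n (X : 'I_n -> R) f g u : 1 <= p ->
  lpnorm p X (f \- g) <= lpnorm p X (f \- u) + lpnorm p X (u \- g).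
Proof.
move=> p1; apply: le_trans (lpnormD X (f \- u) (u \- g) p1).
by rewrite (_ : f \- g = (f \- u) \+ (u \- g))//; apply/funext => x /=; ring.
Qed.

Variables (n : nat) (X : 'I_n -> R) (gamma : R).
Hypotheses (n0 : (0 < n)%N) (g0 : 0 < gamma).
Hypotheses (oX : ordered_nodes X) (sX : separated_nodes X gamma).

Lemma nodes_gap (j k : 'I_n) : (j < k)%N -> X j + gamma / n%:R <= X k.
Proof.
move=> jk; have jn : (j.+1 < n)%N by rewrite (leq_ltn_trans jk).
have := sX j; rewrite /next_node (ltn_eqF jn) addr0 lerBrDl => /le_trans; apply.
have -> : ordS j = Ordinal jn by apply: val_inj; rewrite /= modn_small.
have [<-|neq] := eqVneq (Ordinal jn) k; first by [].
apply/ltW/oX.2; rewrite ltn_neqAle jk andbT.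
by apply: contra neq => /eqP e; apply/eqP/val_inj.
Qed.

(** The gap between the last node and the first one shifted by a period is the one
    that keeps all cells within one period. *)
Lemma nodes_wrap (j k : 'I_n) : X k + gamma / n%:R <= X j + 1.
Proof.
have last_n : (n.-1 < n)%N by rewrite prednK.
pose l := Ordinal last_n; pose o := Ordinal n0.
have Xkl : X k <= X l.
  have [->|kl] := eqVneq k l; first by [].
  apply/ltW/oX.2; rewrite ltn_neqAle -ltnS prednK// ltn_ord andbT.
  by apply: contra kl => /eqP e; apply/eqP/val_inj.
have Xoj : X o <= X j.
  have [->|oj] := eqVneq j o; first by [].
  apply/ltW/oX.2; rewrite lt0n.
  by apply: contra oj => /eqP e; apply/eqP/val_inj.
have := sX l; rewrite /next_node /= prednK// eqxx.
have -> : ordS l = o by apply: val_inj; rewrite /= prednK// modnn.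
rewrite -/l /= mulr1n => h; move: h Xkl Xoj.
move: (X k) (X l) (X o) (X j) (gamma / _) => a b c d e; lra.
Qed.

Local Notation h := (gamma / n%:R).
Definition cell (k : 'I_n) : set R := `[X k - h / 2, X k + h / 2[%classic.

(** The cells are disjoint and contained in the period that starts at the left end
    of the first one. *)
Lemma sum_cells_le (F : R -> \bar R) : measurable_fun [set: R] F ->
  (forall x, 0 <= F x)%E -> (forall x, F (x + 1)%R = F x) ->
  (\sum_(k < n) \int[mu]_(y in cell k) F y <= \int[mu]_(y in `[0%R, 1%R[) F y)%E.
Proof.
move=> mF F0 pF.
have tI : trivIset [set` index_enum 'I_n] cell.
  apply/trivIsetP => j k _ _ jk; rewrite -subset0 => y [].
  rewrite /cell/= !in_itv/= => /andP[j1 j2] /andP[k1 k2].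
  have := jk; rewrite -(inj_eq val_inj) neq_ltn => /orP[/nodes_gap|/nodes_gap] ?; lra.
have mcell k : measurable (cell k) by exact: measurable_itv.
rewrite -ge0_integral_bigsetU//; last 2 first.
- exact: index_enum_uniq.
- exact: measurable_funTS.
pose a := X (Ordinal n0) - h / 2.
rewrite -(periodic_integral a mF F0 pF).
apply: ge0_subset_integral => //.
- by apply: bigsetU_measurable => k _; exact: mcell.
- exact: measurable_funTS.
- move=> y; rewrite -bigcup_seq => -[k _]; rewrite /cell /a /= !in_itv/= => /andP[k1 k2].
  have w := nodes_wrap (Ordinal n0) k.
  have Xok : X (Ordinal n0) <= X k.
    have [->|ok] := eqVneq k (Ordinal n0); first by [].
    apply/ltW/oX.2; rewrite lt0n.
    by apply: contra ok => /eqP e; apply/eqP/val_inj.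
  by apply/andP; split; lra.
Qed.

(** Hoelder on each cell, and summation over disjoint cells.  The factors [1 / n] of
    the discrete norm and [1 / h] of the means multiply to [1 / gamma]; since
    [gamma <= 1], the root [gamma^(-1/p)] is at most [gamma^-1]. *)
Lemma lpnorm_le_Lpnorm p B (v F : R -> R) : 1 <= p -> gamma <= 1 -> 0 <= B ->
  measurable_fun [set: R] F -> periodic F 1 ->
  (forall k, (`|v (X k)|%:E <= (B / h)%:E *
    \int[mu]_(y in `[(X k - h / 2)%R, (X k + h / 2)%R]) (`|F y|)%:E)%E) ->
  ((lpnorm p X v)%:E <= (B / gamma)%:E * Lpnorm p F)%E.
Proof.
move=> p1 gamma1 B0 mF pF vF; have p0 : 0 < p by exact: lt_le_trans p1.
have pn0 : p != 0 by rewrite gt_eqF.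
have nR : 0 < n%:R :> R by rewrite ltr0n.
have h0 : 0 < h by rewrite divr_gt0.
have mP := measurable_abs_powR p mF.
have P0 x := abs_powR_ge0 p F x.
have cellE k (G : R -> \bar R) : measurable_fun [set: R] G ->
    (\int[mu]_(y in `[(X k - h / 2)%R, (X k + h / 2)%R]) G y = \int[mu]_(y in cell k) G y)%E.
  by move=> mG; rewrite -integral_itv_bndo_bndc//; exact: measurable_funTS.
have mN : measurable_fun [set: R] (fun y => (`|F y|)%:E).
  by apply/measurable_EFinP; exact: measurableT_comp.
have mu_cell k : mu (cell k) = h%:E.
  rewrite /cell lebesgue_measure_itv/= lte_fin.
  rewrite (_ : X k - h / 2 < X k + h / 2); last by lra.
  by rewrite -EFinB; congr EFin; field; rewrite gt_eqF.
have mcell k : measurable (cell k) by exact: measurable_itv.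
have vp k : ((`|v (X k)| `^ p)%:E <=
    ((B `^ p) * h^-1)%:E * \int[mu]_(y in cell k) (`|F y| `^ p)%:E)%E.
  have I0 : (0 <= \int[mu]_(y in cell k) (`|F y|)%:E)%E.
    by apply: integral_ge0 => y _; rewrite lee_fin.
  have Bh0 : 0 <= B / h by rewrite divr_ge0// ltW.
  have := vF k; rewrite cellE// => vk.
  apply: (@le_trans _ _ (((B / h)%:E * \int[mu]_(y in cell k) (`|F y|)%:E) `^ p)%E).
    rewrite -poweR_EFin; apply: gt0_ler_poweR => //; first exact: ltW.
    - by rewrite in_itv/= leey lee_fin normr_ge0.
    - by rewrite in_itv/= leey mule_ge0.
  rewrite poweRM ?lee_fin// poweR_EFin.
  apply: (le_trans (lee_wpmul2l _ (hoelder_set p1 (mcell k) h0 (mu_cell k) mF))).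
    by rewrite lee_fin powR_ge0.
  rewrite muleA -EFinM; apply: lee_wpmul2r.
    by apply: integral_ge0 => y _; exact: P0.
  have hV0 : 0 <= h^-1 by rewrite invr_ge0 ltW.
  rewrite lee_fin (powRM p B0 hV0) -mulrA ler_wpM2l ?powR_ge0//.
  rewrite -powR_inv1 ?(ltW h0)// -powRrM mulN1r -powRD; last by rewrite (gt_eqF h0) implybT.
  by rewrite addrA addNr add0r powR_inv1 ?(ltW h0).
have sump : ((n%:R^-1 * \sum_(k < n) `|v (X k)| `^ p)%:E <=
    (B `^ p / gamma)%:E * pow_integral p F)%E.
  apply: (@le_trans _ _ (n%:R^-1%:E * (((B `^ p) * h^-1)%:E * pow_integral p F))%E).
    rewrite EFinM; apply: lee_wpmul2l; first by rewrite lee_fin invr_ge0 ltW.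
    rewrite -sumEFin; apply: (@le_trans _ _ (\sum_(k < n) ((B `^ p) * h^-1)%:E *
      \int[mu]_(y in cell k) (`|F y| `^ p)%:E)%E).
      by apply: lee_sum => k _; exact: vp.
    rewrite -ge0_sume_distrr; last first.
      by move=> k _; apply: integral_ge0 => y _; exact: P0.
    apply: lee_wpmul2l; first by rewrite lee_fin mulr_ge0 ?powR_ge0 ?invr_ge0 ?(ltW h0).
    by apply: sum_cells_le => // x; rewrite pF.
  rewrite muleA -EFinM; apply: lee_wpmul2r; first exact: pow_integral_ge0.
  rewrite lee_fin le_eqVlt; apply/orP; left; apply/eqP.
  by field; rewrite !gt_eqF.
rewrite /lpnorm -poweR_EFin.
apply: (@le_trans _ _ (((B `^ p / gamma)%:E * pow_integral p F) `^ p^-1)%E).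
  apply: gt0_ler_poweR => //; first by rewrite invr_ge0 ltW.
  - rewrite in_itv/= leey lee_fin mulr_ge0 ?invr_ge0//.
    by apply: sumr_ge0 => k _; exact: powR_ge0.
  - rewrite in_itv/= leey mule_ge0 ?pow_integral_ge0// lee_fin.
    by rewrite divr_ge0 ?powR_ge0 ?(ltW g0).
rewrite poweRM ?pow_integral_ge0//; last first.
  by rewrite lee_fin divr_ge0 ?powR_ge0 ?(ltW g0).
rewrite -Lpnorm_borel//; apply: lee_wpmul2r; first exact: Lpnorm_ge0.
rewrite poweR_EFin lee_fin powRM ?powR_ge0 ?invr_ge0 ?(ltW g0)//.
rewrite -powRrM divff// powRr1// ler_wpM2l//.
rewrite -[leRHS]powRr1 ?invr_ge0 ?(ltW g0)//.
by rewrite ler_powR ?invf_le1// invf_ge1.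
Qed.

End Nodes.

(** * Comparison of the Steklov average with a smooth approximant *)

Section Assembly.
Context {R : realType}.
Local Notation mu := (@lebesgue_measure R).
Local Notation leb := (@completed_lebesgue_measure R).
Local Notation T := (lebesgueTypeR R).
Implicit Types (p : R) (f g F : R -> R).

Lemma Lpnorm_locint p F : 1 <= p -> measurable_fun [set: R] F ->
  periodic F 1 -> (Lpnorm p F < +oo)%E -> locint F.
Proof.
move=> p1 mF pF; have p0 : 0 < p by exact: lt_le_trans p1.
have pn0 : p != 0 by rewrite gt_eqF.
rewrite Lpnorm_borel// => Foo; split => // a b.
have mN : measurable_fun [set: R] (fun y => (`|F y|)%:E).
  by apply/measurable_EFinP; exact: measurableT_comp.
have N0 y : (0 <= (`|F y|)%:E)%E by rewrite lee_fin.
apply/integrableP; split; first exact/measurable_funTS/measurable_EFinP.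
have mu1 : mu `[0, 1[%classic = 1%:E.
  by rewrite lebesgue_measure_itv/= lte_fin ltr01 sube0.
have I1 : (\int[mu]_(y in `[0%R, 1%R[) (`|F y|)%:E < +oo)%E.
  have mI : measurable (`[0, 1[%classic : set R) by [].
  have := hoelder_set p1 mI ltr01 mu1 mF; rewrite powR1 mul1e => H.
  apply: (lty_poweRy pn0); apply: (le_lt_trans H).
  by apply: (lty_poweRy _ Foo); rewrite invr_eq0.
(* [a, b] is covered by k periods *)
pose k := Num.bound `|b - a|.
have bk : b < a + k%:R.
  by rewrite -ltrBlDl (le_lt_trans (ler_norm _))// archi_boundP.
apply: (@le_lt_trans _ _ (\int[mu]_(y in `[a, (a + k%:R)%R[) (`|F y|)%:E)%E).
  apply: ge0_subset_integral => //; first exact: measurable_funTS.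
  by move=> y /=; rewrite !in_itv/= => /andP[-> /le_lt_trans ->].
rewrite periodic_integral_nat//; last by move=> y; rewrite pF.
by rewrite lte_mul_pinfty.
Qed.

Lemma continuous_inLp p F : 1 <= p -> continuous F -> periodic F 1 -> inLp p F.
Proof.
move=> p1 cF pF; have p0 : 0 < p by exact: lt_le_trans p1.
have mF := continuous_measurable_fun cF.
split => //; first exact: measurable_fun_lebesgue.
have cN : {within `[0, 1], continuous (fun x => `|F x|)}.
  by apply: continuous_subspaceT => x; apply: cvg_norm; exact: cF.
have [c _ Fc] := EVT_max ler01 cN.
rewrite Lpnorm_borel//; apply: poweR_lty.
apply: (@le_lt_trans _ _ (\int[mu]_(x in `[0%R, 1%R[) (cst (`|F c| `^ p)%:E x))%E).
  apply: ge0_le_integral => //.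
  - by apply: measurable_funTS; exact: measurable_abs_powR.
  - move=> x; rewrite /= in_itv/= => /andP[x0 x1].
    rewrite lee_fin ge0_ler_powR ?nnegrE ?(ltW p0)//.
    by apply: Fc; rewrite in_itv/= x0 ltW.
rewrite integral_cst//= lebesgue_measure_itv/= lte_fin ltr01 sube0 mule1.
exact: ltry.
Qed.

(** The derivative of order [s - 1] is Lipschitz on [0, 1], since the next one is
    continuous. *)
Lemma derivatives_inW p (s : nat) (D : nat -> R -> R) : 1 <= p -> (0 < s)%N ->
  derivatives s D -> continuous (D s) -> periodic (D 0) 1 -> periodic (D s) 1 ->
  inW p s (D 0).
Proof.
move=> p1 s0 dD cD p00 ps; have ED := derive1n_derivatives dD.
have s1s : (s.-1 < s)%N by rewrite prednK.
split => //.
- move=> i is1 x; rewrite ED; last by rewrite (leq_trans (ltnW is1))// leq_pred.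
  by have [] := dD i (leq_trans is1 (leq_pred s)) x.
- rewrite ED ?leq_pred// => e e0.
  have cN : {within `[0, 1], continuous (fun x => `|D s x|)}.
    by apply: continuous_subspaceT => x; apply: cvg_norm; exact: cD.
  have [c _ Dc] := EVT_max ler01 cN.
  pose B := `|D s c| + 1.
  have B0 : 0 < B by rewrite ltr_wpDl.
  exists (e / B); first by rewrite divr_gt0.
  move=> m u v uv _ sumuv.
  have lip i : `|D s.-1 (v i) - D s.-1 (u i)| <= (v i - u i) * B.
    have [u0 uvi v1] := uv i.
    rewrite -[X in _ <= X * _](gtr0_norm (x := v i - u i)) ?subr_gt0//.
    have dDs (x : R) : is_derive x 1 (D s.-1) (D s x).
      by have := dD s.-1 s1s x; rewrite prednK.
    apply: (mean_value_le (lo := 0) (hi := 1) dDs).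
    + move=> y y01; rewrite /B; apply: le_trans (Dc y _) _; last by rewrite lerDl.
      by rewrite in_itv.
    + by rewrite u0 (le_trans (ltW uvi)).
    + by rewrite v1 andbT (le_trans u0)// ltW.
  apply: (@le_lt_trans _ _ (\sum_(i < m) (v i - u i) * B)).
    by apply: ler_sum => i _; exact: lip.
  by rewrite -mulr_suml -ltr_pdivlMr.
- by rewrite ED//; exact: continuous_inLp.
Qed.

Lemma modulus_ge p (s : nat) f (d h : R) : 0 < h < d ->
  (Lpnorm p (fdiff s h f) <= modulus s f d p)%E.
Proof. by move=> hd; apply: ereal_sup_ubound; exists h => //=; rewrite in_itv. Qed.

Lemma modulus_ge0 p (s : nat) f (d : R) : 0 < d -> (0 <= modulus s f d p)%E.
Proof.
move=> d0; apply: (le_trans (Lpnorm_ge0 p (fdiff s (d / 2) f))).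
by apply: modulus_ge; rewrite divr_gt0//= ltr_pdivrMr// ltr_pMr// ltr1n.
Qed.

Lemma Lpnorm_ae_eq p f F : 0 < p -> measurable_fun [set: R] F ->
  {ae mu, forall x, f x = F x} -> Lpnorm p f = Lpnorm p F.
Proof. by move=> p0 mF fF; rewrite (Lpnorm_ae p0 mF fF) Lpnorm_borel. Qed.

Definition bin_total (s : nat) : R := \sum_(nu < s) 'C(s, nu)%:R.

Definition derivative_const (s : nat) : R := bin_total s * s.+2%:R ^+ s.

(** The first term is the contribution of the Steklov average of [f - g], the second
    one that of the deviation of the average of [g] from [g]. *)
Definition node_const (r s : nat) (gamma : R) : R :=
  (2 * r%:R * \sum_(nu < r) 'C(2 * r, nu)%:R) / gamma +
  2 ^+ (2 * r - s) * gamma ^+ s / gamma * derivative_const s.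

Lemma derivative_const_ge0 (s : nat) : 0 <= derivative_const s.
Proof. by rewrite mulr_ge0// sumr_ge0. Qed.

Lemma node_const_ge0 (r s : nat) (gamma : R) : 0 < gamma ->
  0 <= node_const r s gamma.
Proof.
move=> gamma0; have g0 := ltW gamma0.
apply: addr_ge0; last first.
  apply: mulr_ge0; last exact: derivative_const_ge0.
  by rewrite mulr_ge0 ?invr_ge0// mulr_ge0 ?exprn_ge0.
by rewrite mulr_ge0 ?invr_ge0// mulr_ge0 ?mulr_ge0// sumr_ge0.
Qed.

(** All that the two estimates need from the smooth approximant.  The powers of [n]
    cancel in the last bound because [gamma / n] and the step of the approximant are
    both proportional to [1 / n]. *)
Lemma smooth_approximation p (r s n : nat) (X : 'I_n -> R) (gamma : R) f :
  1 <= p -> (0 < r)%N -> (0 < s)%N -> (s <= 2 * r)%N -> 0 < gamma -> gamma <= 1 ->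
  (0 < n)%N -> ordered_nodes X -> separated_nodes X gamma -> inLp p f ->
  exists g, [/\ inW p s g, inLp p (f \- g),
    (Lpnorm p (f \- g)%R <= modulus s f n%:R^-1 p)%E,
    (Lpnorm p (g^`(s))%classic <=
       (derivative_const s * n%:R ^+ s)%:E * modulus s f n%:R^-1 p)%E &
    ((lpnorm p X (steklov (gamma / n%:R) r f \- g)%R)%:E <=
       (node_const r s gamma)%:E * modulus s f n%:R^-1 p)%E].
Proof.
move=> p1 r0 s0 sr gamma0 gamma1 n0 oX sX [pf mf foo].
have p0 : 0 < p by exact: lt_le_trans p1.
have nR : 0 < n%:R :> R by rewrite ltr0n.
pose d : R := n%:R^-1; have d0 : 0 < d by rewrite invr_gt0.
pose h := gamma / n%:R; have h0 : 0 < h by rewrite divr_gt0.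
have [F [mF pF fF]] := periodic_borel_version mf pf.
have Foo : (Lpnorm p F < +oo)%E by rewrite -(Lpnorm_ae_eq p0 mF fF).
have lF := Lpnorm_locint p1 mF pF Foo.
set M := modulus s f _ p.
have M0 : (0 <= M)%E by exact: modulus_ge0.
have FM h' : 0 < h' < d -> (Lpnorm p (fdiff s h' F) <= M)%E.
  move=> hd; have := modulus_ge p s f hd.
  by rewrite (Lpnorm_ae_eq p0 (measurable_fdiff s h' mF) (ae_fdiff s h' fF)).
pose D := approximant d s F.
have dD : derivatives s D by move=> i si x; exact: is_derive_approximant.
have cD : continuous (D s) by exact: continuous_approximant.
have pD i : periodic (D i) 1 by exact: periodic_approximant.
have cg : continuous (D 0) by exact: (derivatives_continuous dD s0).
have gLp : inLp p (D 0) by exact: continuous_inLp.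
have [_ mg goo] := gLp.
have lg := continuous_locint cg.
have mgB : measurable_fun [set: R] (D 0) by exact: continuous_measurable_fun.
have fgE : Lpnorm p (f \- D 0) = Lpnorm p (F \- D 0).
  apply: Lpnorm_ae_eq => //; first exact: measurable_funB.
  by apply: (filterS (F := almost_everywhere mu) _ fF) => x /= ->.
have fgM : (Lpnorm p (f \- D 0)%R <= M)%E.
  by rewrite fgE; apply: (approximant_error p1 d0 s0 lF FM M0).
have DsM : (Lpnorm p (D s) <= (derivative_const s * n%:R ^+ s)%:E * M)%E.
  apply: (le_trans (approximant_derivative_norm p1 d0 lF pF FM)).
  rewrite le_eqVlt; apply/orP; left; apply/eqP; congr (_%:E * _)%E.
  rewrite /derivative_const -mulrA; congr (_ * _).
  by rewrite /base_step /d -exprMn -exprVn invfM !invrK mulrC.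
exists (D 0); split.
- exact: derivatives_inW.
- split; first by move=> x /=; rewrite pf pD.
    by apply: measurable_funB.
  rewrite (Lpnorm_eq p (g := f \+ (fun x => - D 0 x)))//.
  apply: (le_lt_trans (LpnormD p1 mf _)).
    by apply: measurable_fun_lebesgue; exact: measurableT_comp.
  by rewrite LpnormN lte_add_pinfty.
- exact: fgM.
- by rewrite (derive1n_derivatives dD).
- pose v1 := steklov h r (f \- D 0); pose v2 x := steklov h r (D 0) x - D 0 x.
  have lFg : locint (F \- D 0) by exact: locintB.
  have fgF : {ae mu, forall x, (f \- D 0) x = (F \- D 0) x}.
    by apply: (filterS (F := almost_everywhere mu) _ fF) => x /= ->.
  have vE : steklov h r f \- D 0 = v1 \+ v2.
    apply/funext => x /=; rewrite /v1 /v2 (steklovB _ _ _ lF lg fF (ae_refl _)).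
    by rewrite addrA subrK.
  have B1 : (0 : R) <= 2 * r%:R * \sum_(nu < r) 'C(2 * r, nu)%:R.
    by rewrite mulr_ge0// sumr_ge0.
  have v1M : ((lpnorm p X v1)%:E <=
      ((2 * r%:R * \sum_(nu < r) 'C(2 * r, nu)%:R) / gamma)%:E * M)%E.
    have H := lpnorm_le_Lpnorm n0 gamma0 oX sX (v := v1) (F := F \- D 0) p1 gamma1 B1
      lFg.1 _ _.
    apply: (le_trans (H _ _)).
    + by move=> x /=; rewrite pF pD.
    + by move=> k; exact: steklov_le.
    + by rewrite -fgE; apply: lee_wpmul2l => //; rewrite lee_fin divr_ge0// ltW.
  have B2 : (0 : R) <= 2 ^+ (2 * r - s) * h ^+ s.
    by rewrite mulr_ge0// exprn_ge0// ltW.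
  have v2M : ((lpnorm p X v2)%:E <=
      (2 ^+ (2 * r - s) * gamma ^+ s / gamma * derivative_const s)%:E * M)%E.
    have H := lpnorm_le_Lpnorm n0 gamma0 oX sX (v := v2) (F := D s) p1 gamma1 B2
      (continuous_measurable_fun cD) (pD s) _.
    apply: (le_trans (H _)) => [k|].
      have iN : mu.-integrable `[X k - h / 2, X k + h / 2] (EFin \o (fun y => `|D s y|)).
        apply: (continuous_locint _).2.
        by move=> y; apply: cvg_norm; exact: cD.
      have := steklov_sub_le r0 h0 (X k) s0 sr dD cD.
      rewrite -lee_fin => /le_trans; apply.
      rewrite EFinM /Rintegral fineK; last exact: integrable_fin_num.
      apply: lee_wpmul2r; first by apply: integral_ge0 => y _; rewrite lee_fin.
      rewrite lee_fin -mulrA ler_wpM2l//.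
      by rewrite -[X in h ^+ X / _](prednK s0) exprSr mulfK// gt_eqF.
    apply: (le_trans (lee_wpmul2l _ DsM)); first by rewrite lee_fin divr_ge0// ltW.
    rewrite muleA -EFinM le_eqVlt; apply/orP; left; apply/eqP; congr (_%:E * _)%E.
    by rewrite /h expr_div_n; field; rewrite expf_neq0 ?gt_eqF.
  rewrite vE /node_const EFinD ge0_muleDl; last 2 first.
    by rewrite lee_fin divr_ge0// ltW.
    rewrite lee_fin mulr_ge0 ?derivative_const_ge0//.
    by rewrite divr_ge0 ?(ltW gamma0)// mulr_ge0// exprn_ge0 ?(ltW gamma0).
  apply: (le_trans _ (leeD v1M v2M)).
  by rewrite -EFinD lee_fin; exact: lpnormD.
Qed.

End Assembly.

(** * Two-sided estimate of the sampling error *)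

Theorem theorem4p1 (R : realType) (p : R) (r s : nat)
    (X : forall n : nat, 'I_n -> R)
    (phi : forall n : nat, 'I_n -> R -> R)
    (gamma K1 K3 : R) :
  1 <= p -> (0 < r)%N -> (0 < s)%N -> (s <= 2 * r)%N ->
  0 < gamma <= 1 ->
  (forall n : nat, (0 < n)%N -> ordered_nodes (X n)) ->
  (forall n : nat, (0 < n)%N -> separated_nodes (X n) gamma) ->
  (forall (n : nat) (k : 'I_n), inLp p (phi n k)) ->
  0 < K1 -> 0 < K3 ->
  (forall (f : R -> R) (n : nat), inLp p f -> (0 < n)%N ->
    (Lpnorm p (sampling (X n) (phi n) f)
       <= K1%:E * (lpnorm p (X n) f)%:E)%E) ->
  (forall (f : R -> R) (n : nat), inW p s f -> (0 < n)%N ->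
    (Lpnorm p (f \- sampling (X n) (phi n) f)%R
       <= (K3 * n%:R ^- s)%:E * Lpnorm p (f^`(s))%classic)%E) ->
  (exists2 C1 : R, 0 < C1 &
    forall (f : R -> R) (n : nat), inLp p f -> (0 < n)%N ->
      (Lpnorm p (f \- sampling (X n) (phi n) f)%R
         <= K1%:E * (lpnorm p (X n) (steklov (gamma / n%:R) r f \- f)%R)%:E
            + C1%:E * modulus s f n%:R^-1 p)%E) /\
  (forall K2 : R, 0 < K2 ->
    (forall (f : R -> R) (n : nat), inLp p f -> (0 < n)%N ->
      (K2%:E * (lpnorm p (X n) f)%:E
         <= Lpnorm p (sampling (X n) (phi n) f))%E) ->
    exists2 C2 : R, 0 < C2 &
      forall (f : R -> R) (n : nat), inLp p f -> (0 < n)%N ->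
        (K2%:E * (lpnorm p (X n) (steklov (gamma / n%:R) r f \- f)%R)%:E
           - C2%:E * modulus s f n%:R^-1 p
         <= Lpnorm p (f \- sampling (X n) (phi n) f)%R)%E).
Proof.
move=> p1 r0 s0 sr /andP[gamma0 gamma1] oX sX phiLp K10 K30 GK1 GK3.
have N0 : 0 <= node_const r s gamma.
  by rewrite node_const_ge0// ltW.
have Cd0 : 0 <= derivative_const s :> R by exact: derivative_const_ge0.
have mG n f : measurable_fun [set: lebesgueTypeR R]
    (sampling (X n) (phi n) f : lebesgueTypeR R -> R).
  apply: measurable_sum => k; apply: measurable_funM => //.
  by have [] := phiLp n k.
have GB n f g x : sampling (X n) (phi n) (f \- g) x =
    sampling (X n) (phi n) f x - sampling (X n) (phi n) g x.
  by rewrite /sampling -sumrB; apply: eq_bigr => k _; rewrite -mulrBl.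
have gM (f g : R -> R) n : (0 < n)%N -> inW p s g ->
    (Lpnorm p (g^`(s))%classic <=
      (derivative_const s * n%:R ^+ s)%:E * modulus s f n%:R^-1 p)%E ->
    (Lpnorm p (g \- sampling (X n) (phi n) g)%R <=
      (K3 * derivative_const s)%:E * modulus s f n%:R^-1 p)%E.
  move=> n0 gW gs; apply: (le_trans (GK3 g n gW n0)).
  have nR : 0 < n%:R :> R by rewrite ltr0n.
  apply: (le_trans (lee_wpmul2l _ gs)).
    by rewrite lee_fin mulr_ge0 ?invr_ge0 ?exprn_ge0// ltW.
  rewrite muleA -EFinM le_eqVlt; apply/orP; left; apply/eqP; congr (_%:E * _)%E.
  by field; rewrite expf_neq0 ?gt_eqF.
pose C K := 1 + K3 * derivative_const s + K * node_const r s gamma.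
have C0 K : 0 < K -> 0 < C K.
  by move=> K0; rewrite /C -addrA ltr_wpDr// addr_ge0// mulr_ge0// ltW.
have CM K M : 0 < K -> (0 <= M)%E -> ((C K)%:E * M = M +
    (K3 * derivative_const s)%:E * M + K%:E * ((node_const r s gamma)%:E * M))%E.
  move=> K0 M0; rewrite muleA -EFinM /C !EFinD.
  have h1 : 0 <= K3 * derivative_const s by rewrite mulr_ge0// ltW.
  have h2 : 0 <= K * node_const r s gamma by rewrite mulr_ge0// ltW.
  rewrite ge0_muleDl ?lee_fin//; last by rewrite addr_ge0.
  by rewrite ge0_muleDl ?lee_fin// mul1e.
have smooth f n (n0 : (0 < n)%N) (fLp : inLp p f) :=
  smooth_approximation p1 r0 s0 sr gamma0 gamma1 n0 (oX n n0) (sX n n0) fLp.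
have M0 f n : (0 < n)%N -> (0 <= modulus s f n%:R^-1 p)%E.
  by move=> n0; apply: modulus_ge0; rewrite invr_gt0 ltr0n.
have meas f g : inLp p f -> inLp p (f \- g) ->
    measurable_fun [set: lebesgueTypeR R] (g : lebesgueTypeR R -> R).
  move=> [_ mf _] [_ mfg _]; rewrite (_ : g = f \- (f \- g)).
    exact: measurable_funB.
  by apply/funext => x /=; rewrite subKr.
split.
  exists (C K1); first exact: C0.
  move=> f n fLp n0; have [g [gW fgLp fgM gs ng]] := smooth f n n0 fLp.
  have mg := meas f g fLp fgLp; have [_ mfg _] := fgLp.
  have Gg := gM f g n n0 gW gs.
  rewrite CM ?M0//.
  move: (M0 f n n0) fgM Gg ng; set M := modulus s f _ p => M0f fgM Gg ng.
  set fh := steklov (gamma / n%:R) r f in ng *.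
  rewrite (Lpnorm_eq p (g := (f \- g) \+ ((g \- sampling (X n) (phi n) g) \+
    (fun x => - sampling (X n) (phi n) (f \- g) x)))); last first.
    by move=> x /=; rewrite GB; ring.
  have mgG : measurable_fun [set: lebesgueTypeR R]
      ((g \- sampling (X n) (phi n) g) : lebesgueTypeR R -> R).
    exact: measurable_funB.
  have mNG : measurable_fun [set: lebesgueTypeR R]
      ((fun x => - sampling (X n) (phi n) (f \- g) x) : lebesgueTypeR R -> R).
    exact: measurableT_comp.
  apply: (le_trans (LpnormD p1 mfg _)); first exact: measurable_funD.
  rewrite [leRHS]addeC -!addeA; apply: leeD; first exact: fgM.
  apply: (le_trans (LpnormD p1 mgG mNG)); apply: leeD; first exact: Gg.
  rewrite LpnormN; apply: (le_trans (GK1 _ n fgLp n0)).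
  have le_ab : lpnorm p (X n) (f \- g) <=
      lpnorm p (X n) (fh \- g) + lpnorm p (X n) (fh \- f).
    by rewrite addrC (lpnorm_distC _ _ fh f) lpnorm_triangle.
  apply: (@le_trans _ _ (K1%:E * (lpnorm p (X n) (fh \- g)%R +
      lpnorm p (X n) (fh \- f)%R)%:E)%E).
    by apply: lee_wpmul2l; rewrite lee_fin// ltW.
  rewrite EFinD ge0_muleDr ?lee_fin ?lpnorm_ge0//; apply: leeD2r.
  by apply: lee_wpmul2l => //; rewrite lee_fin ltW.
move=> K2 K20 GK2; exists (C K2); first exact: C0.
move=> f n fLp n0; have [g [gW fgLp fgM gs ng]] := smooth f n n0 fLp.
have mg := meas f g fLp fgLp; have [_ mfg _] := fgLp; have [_ mf _] := fLp.
have Gg := gM f g n n0 gW gs.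
move: (M0 f n n0) fgM Gg ng; set M := modulus s f _ p => M0f fgM Gg ng.
(* an infinite modulus makes the left-hand side -oo; a finite one is moved to
   the other side *)
have [Moo|Mfin] := eqVneq M +oo%E.
  by rewrite Moo gt0_muley ?lte_fin ?C0//= addeNy leNye.
have {}Mfin : M \is a fin_num by rewrite ge0_fin_numE// ltey.
rewrite leeBlDr ?fin_numM// CM//.
set fh := steklov (gamma / n%:R) r f in ng *.
have le_ab : lpnorm p (X n) (fh \- f) <=
    lpnorm p (X n) (fh \- g) + lpnorm p (X n) (f \- g).
  by rewrite (lpnorm_distC _ _ f g) lpnorm_triangle.
apply: (@le_trans _ _ (K2%:E * (lpnorm p (X n) (fh \- g)%R +
    lpnorm p (X n) (f \- g)%R)%:E)%E).
  by apply: lee_wpmul2l; rewrite lee_fin// ltW.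
rewrite EFinD ge0_muleDr ?lee_fin ?lpnorm_ge0// [leLHS]addeC addeA.
apply: leeD; last first.
  by apply: lee_wpmul2l => //; rewrite lee_fin ltW.
apply: (le_trans (GK2 _ n fgLp n0)).
rewrite (Lpnorm_eq p (g := (fun x => - (f \- sampling (X n) (phi n) f) x) \+
  ((f \- g) \+ (g \- sampling (X n) (phi n) g)))); last first.
  by move=> x /=; rewrite GB; ring.
have mfG : measurable_fun [set: lebesgueTypeR R]
    ((fun x => - (f \- sampling (X n) (phi n) f) x) : lebesgueTypeR R -> R).
  rewrite (_ : (fun x => _) = sampling (X n) (phi n) f \- f).
    exact: (measurable_funB (mG n f) mf).
  by apply/funext => x /=; rewrite opprB.
have mgG : measurable_fun [set: lebesgueTypeR R]
    ((g \- sampling (X n) (phi n) g) : lebesgueTypeR R -> R).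
  exact: (measurable_funB mg (mG n g)).
apply: (le_trans (LpnormD p1 mfG (measurable_funD mfg mgG))).
rewrite LpnormN; apply: leeD2l.
by apply: (le_trans (LpnormD p1 mfg mgG)); exact: leeD.
Qed.
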